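(* Let $k$ be a field, $Q$ a finite quiver, $R=kQ$, $>$ an admissible order on the set $\mathcal B$ of paths of $Q$, $I$ a two-sided ideal of $R$, $\Lambda=R/I$, and let $\mathcal G=\{g^2_j\}_{j\in\mathcal I}$ be a tip-reduced Gröbner basis of $I$ with respect to $>$ consisting of uniform elements. Let $M$ be a right $\Lambda$-module and let $$0\to \Big(\coprod_{i\in T_1} f^1_iR\Big)\amalg\Big(\coprod_{j\in U_1} {f^1_j}'R\Big)\xrightarrow{H^1}\coprod_{i\in T_0} f^0_iR\xrightarrow{\pi} M\to 0$$ be an exact sequence of right $R$-modules, where $H^1$ is an inclusion, the $f^0_i\in R$ and $f^1_i,{f^1_j}'\in\coprod_{i\in T_0}f^0_iR$ are right uniform, each ${f^1_j}'$ lies in $\coprod_{i\in T_0}f^0_iI$, and $\{f^1_i\}_{i\in T_1}\cup\{{f^1_j}'\}_{j\in U_1}$ is right tip-reduced. Let the index sets $T_2,U_2$ and the elements $f^2_s$ $(s\in T_2)$ and ${f^2_s}'$ $(s\in U_2)$ of $\coprod_{i\in T_1}f^1_iR$ be those constructed from these data in the context. Then $$\Big(\coprod_{i\in T_1}f^1_iR\Big)\cap\Big(\coprod_{i\in T_0}f^0_iI\Big)=\Big(\coprod_{s\in T_2}f^2_sR\Big)\amalg\Big(\coprod_{s\in U_2}{f^2_s}'R\Big)$$ (an internal direct sum inside $\coprod_{i\in T_0}f^0_iR$), and the set $\{f^2_s\}_{s\in T_2}\cup\{{f^2_s}'\}_{s\in U_2}$ is right uniform and right tip-reduced, and hence is a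 right uniform, right tip-reduced right Gröbner basis of $(\coprod_{i\in T_1}f^1_iR)\cap(\coprod_{i\in T_0}f^0_iI)$. Furthermore, each ${f^2_s}'$ lies in $\coprod_{j\in T_1}f^1_jI$.
   Context: Path algebra. $Q_0$ is the vertex set of $Q$; $\mathcal B$ is the set of finite directed paths (vertices are paths of length $0$) and is a $k$-basis of $R=kQ$; for paths $p,q$, the product $pq$ is the concatenation ($p$ followed by $q$) if the terminus of $p$ is the origin of $q$, and $0$ otherwise. A nonzero element $x$ of a right $R$-module is right uniform if $x=xv$ for some $v\in Q_0$; a nonzero $x\in R$ is uniform if $x=uxv$ for some $u,v\in Q_0$. A set is (right) uniform if all its elements are. Admissible order: a well-order $>$ on $\mathcal B$ such that $p>q$ implies $pr>qr$ whenever $pr,qr\neq0$, and $rp>rq$ whenever $rp,rq\ne 0$; and $p=qr$ (all paths) implies $p\ge q$ and $p\ge r$. For $0\ne x\in R$, $\operatorname{tip}(x)$ is the largest path occurring in $x$ with nonzero coefficient. A subset $\mathcal G\subseteq I$ is a Gröbner basis of $I$ if $\{\operatorname{tip}(g):0\neq g\in\mathcal G\}$ and $\{\operatorname{tip}(x):0\ne x\in I\}$ generate the same ideal. For paths, $p\mid q$ means $q=rps$ for some paths $r,s$; $p\mid_l q$ means $q=ps$; $p\mid_r q$ means $q=rp$. A set $X$ of nonzero elements of $R$ is tip-reduced if $x,y\in X$ and $\operatorname{tip}(x)\mid\operatorname{tip}(y)$ imply $x=y$. Tips in direct sums. $P=\coprod_{i\in T_0}f^0_iR$ is the external direct sum,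 with $T_0$ equipped with a fixed well-order. If $f^0_iv_i=f^0_i$ with $v_i\in Q_0$, then $r\mapsto f^0_ir$ is an isomorphism $v_iR\to f^0_iR$. Let $\varepsilon_i\in P$ be the element with $f^0_i$ in coordinate $i$ and $0$ elsewhere; the elements $\varepsilon_ip$ ($i\in T_0$, $p$ a path with origin $v_i$) form a $k$-basis of $P$, well-ordered by: $\varepsilon_ip>\varepsilon_jq$ iff $p>q$, or $p=q$ and $i>j$ in $T_0$. For $0\ne w\in P$, $\operatorname{tip}(w)=\varepsilon_{i}p$ is the largest basis element occurring in $w$; write $\operatorname{tippath}(w)=p$, $\operatorname{tipcoord}(w)=i$. All tips of elements of $P$ are taken in this sense. $\varepsilon_ip$ left divides $\varepsilon_jq$ iff $i=j$ and $p\mid_lq$. A set $X$ of nonzero right uniform elements of $P$ is right tip-reduced if $x,y\in X$ and $\operatorname{tip}(x)$ left divides $\operatorname{tip}(y)$ imply $x=y$. A subset $X$ of a submodule $N\subseteq P$ is a right Gröbner basis of $N$ if the tip of every nonzero element of $N$ is left divisible by the tip of some element of $X$. $f_iI=\{f_ir:r\in I\}$. Construction. For a path $p$, let $X(p)$ be the set of paths $q$ such that (1) $p\mid_lq$; (2) $\operatorname{tip}(g^2_i)\mid_rq$ for some $g^2_i\in\mathcal G$; (3) if $q=r\operatorname{tip}(g^2_j)s$ with paths $r,s$ and $g^2_j\in\mathcal G$, then $s$ is a vertex (hence $j=i$). The element $g^2_i$ is called the end relation of $q$; write $q=q'\operatorname{tip}(g^2_i)$. Let $O(p)$ be the set of $q\in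 X(p)$ with $\operatorname{length}(q')<\operatorname{length}(p)$ (the tip of the end relation overlaps $p$ in a path of length at least one), and $N(p)=X(p)\setminus O(p)$; so $q\in N(p)$ has the form $q=pz\operatorname{tip}(g^2_i)$ with $z$ a path of length $\ge0$. Put $$T_2=\{(i,q): i\in T_1,\ q\in O(\operatorname{tippath}(f^1_i))\},\qquad U_2=\{(i,q): i\in T_1,\ q\in N(\operatorname{tippath}(f^1_i))\}.$$ For $s=(i,q)\in T_2$, let $i^*=\operatorname{tipcoord}(f^1_i)$, let $g^2_j$ be the end relation of $q$, write $q=\operatorname{tippath}(f^1_i)p=q'\operatorname{tip}(g^2_j)$, and let $c\in k$ be the coefficient of the tip of $f^1_i$ divided by the coefficient of the tip of $g^2_j$. The element $f^1_ip-\varepsilon_{i^*}cq'g^2_j$ lies in $\ker\pi$, so it can be written uniquely as $\sum_{l\in T_1}f^1_lr_l+\sum_{l\in U_1}{f^1_l}'s_l$ (uniqueness of each summand $f^1_lr_l$, ${f^1_l}'s_l$); set $f^2_s=f^1_ip-\sum_{l\in T_1}f^1_lr_l$. For $s=(i,q)\in U_2$ with end relation $g^2_j$ and $q=\operatorname{tippath}(f^1_i)z\operatorname{tip}(g^2_j)$, set ${f^2_s}'=f^1_izg^2_j$. *)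

(* Defs.v *)
From HB Require Import structures.
From mathcomp Require Import all_boot all_order all_algebra.
From mathcomp Require Import finmap.
From mathcomp Require Import boolp classical_sets.
From mathcomp Require Import monalg.

Set Implicit Arguments.
Unset Strict Implicit.
Unset Printing Implicit Defensive.

Import GRing.Theory.
Local Open Scope ring_scope.
Local Open Scope classical_set_scope.

(* {malg G[K]} is the type of finitely supported functions K -> G. *)

(* The strict relation [lt x y] stands for [y > x]. *)
Record well_order (T : eqType) (lt : rel T) : Prop := WellOrder {
  wo_trans : transitive lt;
  wo_total : forall x y, [|| x == y, lt x y | lt y x];
  wo_wf : well_founded (fun x y => lt x y)
}.

Section Families.
Variable V : zmodType.

Definition msum (S : choiceType) (x : {malg V[S]}) : V :=
  \sum_(s <- msupp x) x@_s.

(* Families (x_s) of finite support, supported in D, with x_s in A s. *)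
Definition family_in (S : choiceType) (D : set S) (A : S -> set V) :
    set {malg V[S]} :=
  [set x | forall s, s \in msupp x -> D s /\ A s x@_s].

(* The sum of the subgroups A s, for s in D. *)
Definition sum_of (S : choiceType) (D : set S) (A : S -> set V) : set V :=
  @msum S @` family_in D A.

(* N is the internal direct sum of the A1 s, s in D1, and the A2 s, s in D2. *)
Definition internal_dsum2 (N : set V) (S1 S2 : choiceType)
    (D1 : set S1) (A1 : S1 -> set V) (D2 : set S2) (A2 : S2 -> set V) : Prop :=
  (forall w, N w <-> exists x y,
     [/\ family_in D1 A1 x, family_in D2 A2 y & w = msum x + msum y]) /\
  (forall x y, family_in D1 A1 x -> family_in D2 A2 y ->
     msum x + msum y = 0 -> x = 0 /\ y = 0).

End Families.

(* Right R-modules are left modules over the converse ring R^c. *)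
Definition ract (R : pzRingType) (M : lmodType R^c) (m : M) (r : R) : M :=
  (r : R^c) *: m.
Notation "m :* r" := (ract m r) : ring_scope.

Definition cyclic_submod (R : pzRingType) (M : lmodType R^c) (I : set R)
  (m : M) : set M := ract m @` I.

(* The free right R-module on T, with its own scaling: the one that {malg R[T]}
   has in the library is the left action. *)
Definition rfree (R : pzRingType) (T : choiceType) : Type := {malg R[T]}.
HB.instance Definition _ (R : pzRingType) (T : choiceType) :=
  GRing.Zmodule.on (rfree R T).

Section FreeRight.
Variables (R : pzRingType) (T : choiceType).
Implicit Types (w : rfree R T) (r : R^c).

Definition rfree_scale r w : rfree R T :=
  \sum_(i <- msupp w) << w@_i * (r : R) *g i >>.

Lemma rfree_scaleE r w i : (rfree_scale r w)@_i = w@_i * (r : R).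
Proof.
rewrite {2}[w]monalgE !raddf_sum mulr_suml.
by apply/eq_bigr=> /= j _; rewrite !mcoeffU mulrnAl.
Qed.

Lemma rfree_scaleA r1 r2 w :
  rfree_scale r1 (rfree_scale r2 w) = rfree_scale (r1 * r2) w.
Proof. by apply/malgP=> i; rewrite !rfree_scaleE -mulrA. Qed.

Lemma rfree_scale1 : left_id (1 : R^c) rfree_scale.
Proof. by move=> w; apply/malgP=> i; rewrite rfree_scaleE mulr1. Qed.

Lemma rfree_scaleDr : right_distributive rfree_scale +%R.
Proof.
by move=> r w1 w2; apply/malgP=> i; rewrite !(mcoeffD, rfree_scaleE) mulrDl.
Qed.

Lemma rfree_scaleDl w : {morph rfree_scale^~ w : r1 r2 / r1 + r2}.
Proof.
by move=> r1 r2; apply/malgP=> i; rewrite !(mcoeffD, rfree_scaleE) mulrDr.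
Qed.

HB.instance Definition _ := GRing.Zmodule_isLmodule.Build R^c (rfree R T)
  rfree_scaleA rfree_scale1 rfree_scaleDr rfree_scaleDl.

Lemma mcoeff_ract w (r : R) i : (w :* r)@_i = w@_i * r.
Proof. exact: rfree_scaleE. Qed.

End FreeRight.

(* The external direct sum of the right ideals (f i)R. *)
Section Coproduct.
Variables (R : pzRingType) (T : choiceType) (f : T -> R).

Definition in_coprod : {pred rfree R T} :=
  fun w => `[< forall i, exists r : R, w@_i = f i * r >].

Fact in_coprod_closed : GRing.subsemimod_closed in_coprod.
Proof.
split; [split|].
- by apply/asboolP => i; exists 0; rewrite mcoeff0 mulr0.
- move=> u v /asboolP uP /asboolP vP; apply/asboolP => i.
  have [[r ur] [s vs]] := (uP i, vP i).
  by exists (r + s); rewrite mcoeffD ur vs mulrDr.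
- move=> a u /asboolP uP; apply/asboolP => i; have [r ur] := uP i.
  by exists (r * (a : R)); rewrite rfree_scaleE ur mulrA.
Qed.

HB.instance Definition _ :=
  GRing.isSubmodClosed.Build R^c (rfree R T) in_coprod in_coprod_closed.

Record coprod := Coprod { coprod_val :> rfree R T; _ : in_coprod coprod_val }.
HB.instance Definition _ := [isSub for coprod_val].
HB.instance Definition _ := [Choice of coprod by <:].
HB.instance Definition _ := [SubChoice_isSubLmodule of coprod by <:].

Definition coord (w : coprod) (i : T) : R := (coprod_val w)@_i.

Fact eps_subproof i : in_coprod << f i *g i >>.
Proof.
apply/asboolP => j; rewrite mcoeffU; case: eqP => [->|_].
  by exists 1; rewrite mulr1.
by exists 0; rewrite mulr0.
Qed.

(* f i in coordinate i, and 0 elsewhere. *)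
Definition eps (i : T) : coprod := Coprod (eps_subproof i).

(* The coproduct of the (f i)I. *)
Definition coprod_ideal (I : set R) : set coprod :=
  [set w | forall i, exists2 r, I r & coord w i = f i * r].

End Coproduct.

Record two_sided_ideal (R : pzRingType) (I : set R) : Prop := TwoSidedIdeal {
  ideal0 : I 0;
  idealD : forall x y, I x -> I y -> I (x + y);
  idealMl : forall r x, I x -> I (r * x);
  idealMr : forall r x, I x -> I (x * r)
}.

Definition ideal_generated (R : pzRingType) (X : set R) : set R :=
  [set x | forall J : set R, two_sided_ideal J -> X `<=` J -> J x].

Record quiver := Quiver {
  qvert : finType;
  qarr : finType;
  qsrc : qarr -> qvert;
  qtgt : qarr -> qvert
}.

Section Paths.
Variable Q : quiver.

Fixpoint is_walk (v : qvert Q) (s : seq (qarr Q)) : bool :=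
  if s is a :: s' then (qsrc a == v) && is_walk (qtgt a) s' else true.

(* The origin and the arrows of a path. *)
Record qpath := QPath {
  qpath_val : qvert Q * seq (qarr Q);
  _ : is_walk qpath_val.1 qpath_val.2
}.
HB.instance Definition _ := [isSub for qpath_val].
HB.instance Definition _ := [Countable of qpath by <:].

Definition porigin (p : qpath) : qvert Q := (qpath_val p).1.
Definition parrows (p : qpath) : seq (qarr Q) := (qpath_val p).2.
Definition pterminus (p : qpath) : qvert Q :=
  last (porigin p) (map (@qtgt Q) (parrows p)).
Definition plength (p : qpath) : nat := size (parrows p).

Definition vpath (v : qvert Q) : qpath := @QPath (v, [::]) isT.

(* p followed by q, or None if they do not compose. *)
Definition pmul (p q : qpath) : option qpath :=
  if pterminus p == porigin q then insub (porigin p, parrows p ++ parrows q)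
  else None.

(* p |_l q means that p is a prefix of q, p |_r q that it is a suffix. *)
Definition pdvd (p q : qpath) : Prop :=
  exists r s t, pmul r p = Some t /\ pmul t s = Some q.
Definition pdvdl (p q : qpath) : Prop := exists s, pmul p s = Some q.
Definition pdvdr (p q : qpath) : Prop := exists r, pmul r p = Some q.

Lemma is_walk_cat v s1 s2 :
  is_walk v (s1 ++ s2) =
  is_walk v s1 && is_walk (last v (map (@qtgt Q) s1)) s2.
Proof. by elim: s1 v => //= a s1 IH v; rewrite IH andbA. Qed.

Lemma qpath_walk p : is_walk (porigin p) (parrows p).
Proof. exact: valP p. Qed.

Lemma pmulP p q r :
  reflect [/\ pterminus p = porigin q, porigin r = porigin p
            & parrows r = parrows p ++ parrows q]
          (pmul p q == Some r).
Proof.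
rewrite /pmul; case: (pterminus p =P porigin q) => [tpq|ntpq]; last by apply: (iffP eqP) => // -[].
apply: (iffP eqP) => [|[_ rp rs]].
  by case: insubP => // u _ uE [<-]; rewrite /porigin /parrows uE.
have -> : (porigin p, parrows p ++ parrows q) = val r.
  by rewrite -rp -rs [RHS]surjective_pairing.
exact: valK.
Qed.

Lemma pmul_comp p q : pterminus p = porigin q -> exists r, pmul p q = Some r.
Proof.
move=> tpq.
have w : is_walk (porigin p) (parrows p ++ parrows q).
  by rewrite is_walk_cat -/(pterminus p) tpq !qpath_walk.
by exists (@QPath (porigin p, parrows p ++ parrows q) w); apply/eqP/pmulP.
Qed.

Lemma qpath_eq p q : porigin p = porigin q -> parrows p = parrows q -> p = q.
Proof.
rewrite /porigin /parrows => e1 e2; apply: val_inj.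
by move: e1 e2 => /=; case: (qpath_val p) (qpath_val q) => [? ?] [? ?] /= -> ->.
Qed.

Lemma pmul_terminus p q r : pmul p q = Some r -> pterminus r = pterminus q.
Proof.
move=> /eqP/pmulP[tpq ro ra].
by rewrite /pterminus ra map_cat last_cat ro -/(pterminus p) tpq.
Qed.

Lemma pmulA p q s :
  obind (pmul^~ s) (pmul p q) = obind (pmul p) (pmul q s).
Proof.
case: (boolP (pterminus p == porigin q)) => [/eqP tpq|npq]; last first.
  have -> : pmul p q = None by rewrite /pmul (negPf npq).
  rewrite /=; case E: (pmul q s) => [u|] //=.
  by move/eqP: E => /pmulP[_ uo _]; rewrite /pmul uo (negPf npq).
have [u pq] := pmul_comp tpq; rewrite pq /=.
case: (boolP (pterminus q == porigin s)) => [/eqP tqs|nqs]; last first.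
  have -> : pmul q s = None by rewrite /pmul (negPf nqs).
  by rewrite /= /pmul (pmul_terminus pq) (negPf nqs).
have [v qs] := pmul_comp tqs; rewrite qs /=.
have /eqP/pmulP[_ uo ua] := pq; have /eqP/pmulP[_ vo va] := qs.
have tus : pterminus u = porigin s by rewrite (pmul_terminus pq).
have tpv : pterminus p = porigin v by rewrite vo.
have [x xE] := pmul_comp tus; have [y yE] := pmul_comp tpv.
rewrite xE yE; congr Some.
move: xE yE => /eqP/pmulP[_ xo xa] /eqP/pmulP[_ yo ya].
by apply: qpath_eq; rewrite ?xo ?yo ?xa ?ya ?uo // ua va catA.
Qed.

Lemma pmul_vl v p :
  pmul (vpath v) p = if v == porigin p then Some p else None.
Proof.
case: ifP => [/eqP vp|vp]; last by rewrite /pmul /pterminus /= vp.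
by apply/eqP/pmulP; split; rewrite // vp.
Qed.

Lemma pmul_vr v p :
  pmul p (vpath v) = if v == pterminus p then Some p else None.
Proof.
case: ifP => [/eqP vp|vp]; last by rewrite /pmul eq_sym vp.
by apply/eqP/pmulP; split; rewrite // cats0.
Qed.

End Paths.

Definition palg (k : fieldType) (Q : quiver) : Type := {malg k[qpath Q]}.
HB.instance Definition _ (k : fieldType) (Q : quiver) :=
  GRing.Lmodule.on (palg k Q).

Section PathAlgebra.
Variables (k : fieldType) (Q : quiver).
Local Notation R := (palg k Q).
Implicit Types (x y z : R) (p q r : qpath Q) (a b c : k).

Definition monmul c p q : R := if pmul p q is Some r then << c *g r >> else 0.

Definition palg_mul x y : R :=
  \sum_(p <- msupp x) \sum_(q <- msupp y) monmul (x@_p * y@_q) p q.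

Definition palg_one : R := \sum_(v : qvert Q) << vpath v >>.

Lemma monmul0 p q : monmul 0 p q = 0.
Proof. by rewrite /monmul; case: pmul => // r; rewrite monalgU0. Qed.

Lemma monmulD a b p q : monmul (a + b) p q = monmul a p q + monmul b p q.
Proof. by rewrite /monmul; case: pmul => [r|]; rewrite ?monalgUD ?addr0. Qed.

Lemma palg_mulw (d1 d2 : {fset qpath Q}) x y :
  (msupp x `<=` d1)%fset -> (msupp y `<=` d2)%fset ->
  palg_mul x y = \sum_(p <- d1) \sum_(q <- d2) monmul (x@_p * y@_q) p q.
Proof.
move=> s1 s2; rewrite /palg_mul.
rewrite (big_fset_incl _ s1) /=; last first.
  move=> p _ /mcoeff_outdom xp; rewrite big1 // => q _.
  by rewrite xp mul0r monmul0.
apply: eq_bigr => p _; apply: big_fset_incl => // q _ /mcoeff_outdom yq.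
by rewrite yq mulr0 monmul0.
Qed.

Lemma palg_mulDl : left_distributive palg_mul +%R.
Proof.
move=> x y z.
pose d := (msupp x `|` msupp y)%fset.
rewrite (@palg_mulw d (msupp z)) ?msuppD_le //.
rewrite (@palg_mulw d (msupp z) x) ?fsubsetUl //.
rewrite (@palg_mulw d (msupp z) y) ?fsubsetUr //.
rewrite -big_split; apply: eq_bigr => p _; rewrite -big_split.
by apply: eq_bigr => q _; rewrite mcoeffD mulrDl monmulD.
Qed.

Lemma palg_mulDr : right_distributive palg_mul +%R.
Proof.
move=> z x y.
pose d := (msupp x `|` msupp y)%fset.
rewrite (@palg_mulw (msupp z) d) ?msuppD_le //.
rewrite (@palg_mulw (msupp z) d _ x) ?fsubsetUl //.
rewrite (@palg_mulw (msupp z) d _ y) ?fsubsetUr //.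
rewrite -big_split; apply: eq_bigr => p _; rewrite -big_split.
by apply: eq_bigr => q _; rewrite mcoeffD mulrDr monmulD.
Qed.

Lemma palg_mulUU a b p q : palg_mul << a *g p >> << b *g q >> = monmul (a * b) p q.
Proof.
rewrite (palg_mulw (msuppU_le) (msuppU_le)) !big_seq_fset1.
by rewrite !mcoeffUU.
Qed.

Lemma palg_mul0l x : palg_mul 0 x = 0.
Proof. by rewrite /palg_mul msupp0 big_seq_fset0. Qed.

Lemma palg_mul0r x : palg_mul x 0 = 0.
Proof. by rewrite /palg_mul big1 // => p _; rewrite msupp0 big_seq_fset0. Qed.

Section Biadditive.
Variable m : R -> R -> R.
Hypotheses (mDl : left_distributive m +%R) (mDr : right_distributive m +%R).
Hypotheses (m0l : forall x, m 0 x = 0) (m0r : forall x, m x 0 = 0).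

Lemma biadd_suml (T : Type) (s : seq T) (F : T -> R) x :
  m (\sum_(i <- s) F i) x = \sum_(i <- s) m (F i) x.
Proof. by apply: (big_morph (m^~ x)) => [? ?|]; rewrite ?mDl ?m0l. Qed.

Lemma biadd_sumr (T : Type) (s : seq T) (F : T -> R) x :
  m x (\sum_(i <- s) F i) = \sum_(i <- s) m x (F i).
Proof. by apply: (big_morph (m x)) => [? ?|]; rewrite ?mDr ?m0r. Qed.

Lemma biadd_assoc :
  (forall a b c p q r, m << a *g p >> (m << b *g q >> << c *g r >>)
                     = m (m << a *g p >> << b *g q >>) << c *g r >>) ->
  associative m.
Proof.
move=> mU x y z; rewrite [x]monalgE !biadd_suml; apply: eq_bigr => p _.
rewrite [y]monalgE biadd_suml !biadd_sumr biadd_suml; apply: eq_bigr => q _.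
by rewrite [z]monalgE !biadd_sumr; apply: eq_bigr => r _.
Qed.

Lemma biadd_left_id (S : Type) (s : seq S) (F : S -> R) :
  (forall a p, \sum_(v <- s) m (F v) << a *g p >> = << a *g p >>) ->
  left_id (\sum_(v <- s) F v) m.
Proof.
move=> mU x; rewrite [x]monalgE biadd_sumr; apply: eq_bigr => p _.
by rewrite biadd_suml mU.
Qed.

Lemma biadd_right_id (S : Type) (s : seq S) (F : S -> R) :
  (forall a p, \sum_(v <- s) m << a *g p >> (F v) = << a *g p >>) ->
  right_id (\sum_(v <- s) F v) m.
Proof.
move=> mU x; rewrite [x]monalgE biadd_suml; apply: eq_bigr => p _.
by rewrite biadd_sumr mU.
Qed.

End Biadditive.

Lemma palg_mulA : associative palg_mul.
Proof.
apply: (biadd_assoc palg_mulDl palg_mulDr palg_mul0l palg_mul0r).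
move=> a b c p q r.
rewrite !palg_mulUU; have := pmulA p q r; rewrite /monmul.
case: (pmul p q) => [u|]; case: (pmul q r) => [v|] /=;
  rewrite ?palg_mul0l ?palg_mul0r ?palg_mulUU /monmul ?mulrA => E //.
- by rewrite E.
- by rewrite E.
- by rewrite -E.
Qed.

Lemma palg_mul1l : left_id palg_one palg_mul.
Proof.
apply: (biadd_left_id palg_mulDl palg_mulDr palg_mul0l palg_mul0r) => a p.
rewrite (bigD1 (porigin p)) //= big1.
  by rewrite addr0 palg_mulUU /monmul pmul_vl eqxx mul1r.
by move=> v /negPf vp; rewrite palg_mulUU /monmul pmul_vl vp.
Qed.

Lemma palg_mul1r : right_id palg_one palg_mul.
Proof.
apply: (biadd_right_id palg_mulDl palg_mulDr palg_mul0l palg_mul0r) => a p.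
rewrite (bigD1 (pterminus p)) //= big1.
  by rewrite addr0 palg_mulUU /monmul pmul_vr eqxx mulr1.
by move=> v /negPf vp; rewrite palg_mulUU /monmul pmul_vr vp.
Qed.

HB.instance Definition _ := GRing.Zmodule_isPzRing.Build (palg k Q)
  palg_mulA palg_mul1l palg_mul1r palg_mulDl palg_mulDr.

Definition pmon p : R := << p >>.
Definition pvert (v : qvert Q) : R := pmon (vpath v).

Lemma palg_mulE x y : x * y = palg_mul x y.
Proof. by []. Qed.

Lemma pmonM p q : pmon p * pmon q = if pmul p q is Some r then pmon r else 0.
Proof. by rewrite palg_mulE palg_mulUU mulr1. Qed.

Lemma palg_scalerAl c x y : c *: (x * y) = (c *: x) * y.
Proof.
rewrite !palg_mulE (@palg_mulw (msupp x) (msupp y) (c *: x)) ?msuppZ_le //.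
rewrite /palg_mul scaler_sumr; apply: eq_bigr => p _.
rewrite scaler_sumr; apply: eq_bigr => q _.
rewrite mcoeffZ -mulrA /monmul; case: pmul => [r|]; last by rewrite scaler0.
by apply/malgP => s; rewrite mcoeffZ !mcoeffU mulrnAr.
Qed.

Lemma palg_scalerAr c x y : c *: (x * y) = x * (c *: y).
Proof.
rewrite !palg_mulE (@palg_mulw (msupp x) (msupp y) _ (c *: y)) ?msuppZ_le //.
rewrite /palg_mul scaler_sumr; apply: eq_bigr => p _.
rewrite scaler_sumr; apply: eq_bigr => q _.
rewrite mcoeffZ mulrCA /monmul; case: pmul => [r|]; last by rewrite scaler0.
by apply/malgP => s; rewrite mcoeffZ !mcoeffU mulrnAr.
Qed.

Definition uniform x : Prop :=
  x != 0 /\ exists u v, x = pvert u * x * pvert v.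

Definition right_uniform (M : lmodType R^c) (m : M) : Prop :=
  m != 0 /\ exists v, m = m :* pvert v.

End PathAlgebra.

(* p is the largest element of the basis K occurring in x. *)
Definition is_tip (k : fieldType) (K : choiceType) (lt : rel K)
    (x : {malg k[K]}) (p : K) : Prop :=
  p \in msupp x /\ forall q, q \in msupp x -> q = p \/ lt q p.

Record admissible (Q : quiver) (lt : rel (qpath Q)) : Prop := Admissible {
  adm_wo : well_order lt;
  adm_mulr : forall p q r p' q' : qpath Q, lt q p ->
    pmul p r = Some p' -> pmul q r = Some q' -> lt q' p';
  adm_mull : forall p q r p' q' : qpath Q, lt q p ->
    pmul r p = Some p' -> pmul r q = Some q' -> lt q' p';
  adm_factor : forall p q r : qpath Q, pmul q r = Some p ->
    (q = p \/ lt q p) /\ (r = p \/ lt r p)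
}.

Section Grobner.
Variables (k : fieldType) (Q : quiver) (lt : rel (qpath Q)).
Local Notation R := (palg k Q).
Implicit Types (I G X : set R) (p q : qpath Q).

Definition tips X : set R :=
  [set t | exists x p, [/\ X x, is_tip lt x p & t = pmon k p]].

Definition grobner_basis I G : Prop :=
  G `<=` I /\ ideal_generated (tips G) = ideal_generated (tips I).

Definition tip_reduced X : Prop :=
  forall x y p q, X x -> X y -> is_tip lt x p -> is_tip lt y q ->
    pdvd p q -> x = y.

(* q = q' tip(g) with g in G. *)
Definition ends_with G q (g : R) q' : Prop :=
  G g /\ exists2 b, is_tip lt g b & pmul q' b = Some q.

Definition Xset G p : set (qpath Q) :=
  [set q | [/\ pdvdl p q, exists g q', ends_with G q g q' &
    forall g b r s t, G g -> is_tip lt g b ->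
      pmul r b = Some t -> pmul t s = Some q -> plength s = 0%N]].

Definition Oset G p : set (qpath Q) :=
  [set q | Xset G p q /\
    exists g q', ends_with G q g q' /\ (plength q' < plength p)%N].

Definition Nset G p : set (qpath Q) := Xset G p `\` Oset G p.

End Grobner.

Section Construction.
Variables (k : fieldType) (Q : quiver) (lt : rel (qpath Q)).
Local Notation R := (palg k Q).
Variables (T0 : choiceType) (lt0 : rel T0).
(* v0 i is the vertex with f0 i * v0 i = f0 i. *)
Variables (v0 : T0 -> qvert Q) (f0 : T0 -> R).
Local Notation P := (coprod f0).
Implicit Types (w : P) (X N : set P).

Definition basis_lt (x y : T0 * qpath Q) : bool :=
  lt x.2 y.2 || (x.2 == y.2) && lt0 x.1 y.1.

(* Coefficients of w on the basis of the eps i p, with p of origin v0 i. *)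
Definition is_expansion w (c : {malg k[(T0 * qpath Q)%type]}) : Prop :=
  (forall x, x \in msupp c -> porigin x.2 = v0 x.1) /\
  w = \sum_(x <- msupp c) eps f0 x.1 :* (c@_x *: pmon k x.2).
Definition expansion w : {malg k[(T0 * qpath Q)%type]} :=
  xget 0 [set c | is_expansion w c].

(* tipcoord w = i and tippath w = p *)
Definition is_tipP w (i : T0) (p : qpath Q) : Prop :=
  is_tip basis_lt (expansion w) (i, p).

Definition left_divides (x y : T0 * qpath Q) : Prop :=
  x.1 = y.1 /\ pdvdl x.2 y.2.

Definition right_tip_reduced X : Prop :=
  forall x y i j p q, X x -> X y -> is_tipP x i p -> is_tipP y j q ->
    left_divides (i, p) (j, q) -> x = y.

Definition right_grobner_basis N X : Prop :=
  X `<=` N /\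
  forall w j q, N w -> w != 0 -> is_tipP w j q ->
    exists x i p, [/\ X x, is_tipP x i p & left_divides (i, p) (j, q)].

Variables (G : set R) (T1 U1 : choiceType) (f1 : T1 -> P) (f1' : U1 -> P).

Definition T2set : set (T1 * qpath Q) :=
  [set s | exists i a, is_tipP (f1 s.1) i a /\ Oset lt G a s.2].

Definition U2set : set (T1 * qpath Q) :=
  [set s | exists i a, is_tipP (f1 s.1) i a /\ Nset lt G a s.2].

(* istar, a : tipcoord and tippath of f1 s.1; g : end relation of s.2, with
   tip b; x, x' : the families (f1 l * r l) and (f1' l * s l). *)
Definition f2_spec (s : T1 * qpath Q) (y : P) : Prop :=
  exists istar a g b q' p (x : {malg P[T1]}) (x' : {malg P[U1]}),
    [/\ is_tipP (f1 s.1) istar a,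
        [/\ G g, is_tip lt g b & pmul q' b = Some s.2],
        pmul a p = Some s.2,
        [/\ family_in setT (fun l => cyclic_submod setT (f1 l)) x,
            family_in setT (fun l => cyclic_submod setT (f1' l)) x' &
            let c := (expansion (f1 s.1))@_(istar, a) / g@_b in
            f1 s.1 :* pmon k p - eps f0 istar :* (c *: (pmon k q' * g))
              = msum x + msum x'] &
        y = f1 s.1 :* pmon k p - msum x].

(* f2_spec has exactly one solution for s in T2set; f2 is junk elsewhere. *)
Definition f2 (s : T1 * qpath Q) : P := xget 0 [set y | f2_spec s y].

Definition f2'_spec (s : T1 * qpath Q) (y : P) : Prop :=
  exists istar a g q' z,
    [/\ is_tipP (f1 s.1) istar a, ends_with lt G s.2 g q',
        pmul a z = Some q' & y = f1 s.1 :* (pmon k z * g)].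
Definition f2' (s : T1 * qpath Q) : P := xget 0 [set y | f2'_spec s y].

End Construction.

(* Main.v *)
Require Import Defs.
From HB Require Import structures.
From mathcomp Require Import all_boot all_order all_algebra.
From mathcomp Require Import finmap.
From mathcomp Require Import boolp classical_sets.
From mathcomp Require Import monalg.

Set Implicit Arguments.
Unset Strict Implicit.
Unset Printing Implicit Defensive.

Import GRing.Theory.
Local Open Scope ring_scope.
Local Open Scope classical_set_scope.

(* Every element of the free module P has a tip, and the tip of [x r] is the tip
   of [x] times a path when [x] is right uniform.  Since tips of multiples of
   pairwise left-incomparable elements are distinct, such elements generate a
   direct sum, whose nonzero elements have a tip left divisible by the tip of one
   of the generators; conversely a right Groebner basis with incomparable tips
   generates its submodule, by well-founded induction on tips.

   The tip of [f2 s], for [s = (i, q)], is [eps_(i^* ) q]: the correction terms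
   [f1_l r_l] and [f1'_l s_l] sum to an element whose tip is smaller, and none of
   them can exceed that tip.  The same holds for [f2' s].  If q is a prefix of q'
   and both are admitted by condition (3), they are equal, hence the new tips are
   incomparable.

   Groebner property: let w be in the intersection, with tip [eps_j q].  Some
   tippath a of an [f1_l] is a prefix of q, and q contains the tip of an element
   of G since the j-th component of w is in I.  Let q0 be the shortest prefix of
   q ending in such a tip, [q0 = q' tip(g)].  If q0 were shorter than a, then
   [eps_j q' g], which is in the kernel of pi, would have a tip left divisible by
   that of another [f1] or [f1'], against tip-reducedness.  So a is a prefix of
   q0, and [(l, q0)] is an index of T2 or U2 whose tip divides that of w. *)

(** * Well-orders *)

Section WellOrder.
Variables (T : eqType) (lt : rel T).
Hypothesis lt_wo : well_order lt.

Lemma wo_irr x : lt x x = false.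
Proof.
elim/(well_founded_ind (wo_wf lt_wo)): x => x IH.
by apply/negP => xx; move: (IH x xx); rewrite xx.
Qed.

Lemma wo_asym x y : lt x y -> lt y x = false.
Proof.
by move=> xy; apply/negP => /(wo_trans lt_wo xy); rewrite wo_irr.
Qed.

Lemma wo_max (s : seq T) : s != [::] ->
  exists2 x, x \in s & forall y, y \in s -> y = x \/ lt y x.
Proof.
elim: s => // x s IH _; have [->|/IH[y ys ymax]] := eqVneq s [::].
  by exists x; rewrite ?mem_head // => y; rewrite inE => /eqP; left.
case/or3P: (wo_total lt_wo x y) => [/eqP xy|xy|yx].
- exists y; rewrite ?inE ?ys ?orbT // => z; rewrite inE => /orP[/eqP->|/ymax//].
  by left.
- exists y; rewrite ?inE ?ys ?orbT // => z; rewrite inE => /orP[/eqP->|/ymax//].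
  by right.
- exists x; rewrite ?mem_head // => z; rewrite inE => /orP[/eqP->|]; first by left.
  by move=> /ymax[->|zy]; right => //; apply: (wo_trans lt_wo) yx.
Qed.

End WellOrder.

(** * Tips of finitely supported functions *)

Section Tips.
Variables (k : fieldType) (K : choiceType) (lt : rel K).
Hypothesis lt_wo : well_order lt.
Implicit Types (x y : {malg k[K]}) (p q : K).

Lemma tip_exists x : x != 0 -> exists p, is_tip lt x p.
Proof.
move=> x0; have : enum_fset (msupp x) != [::].
  apply: contra_neq x0 => sx; apply/malgP => p; rewrite mcoeff0; apply: mcoeff_outdom.
  by rewrite -[p \in _]/(p \in enum_fset (msupp x)) sx.
by case/(wo_max lt_wo) => p px pmax; exists p; split.
Qed.

Lemma tip_unique x p q : is_tip lt x p -> is_tip lt x q -> p = q.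
Proof.
move=> [px pmax] [qx qmax]; case: (pmax _ qx) => // qp.
by case: (qmax _ px) => // /(wo_asym lt_wo); rewrite qp.
Qed.

Lemma tip_neq0 x p : is_tip lt x p -> x@_p != 0.
Proof. by case; rewrite mcoeff_neq0. Qed.

Lemma tip_le x p q : is_tip lt x p -> x@_q != 0 -> q = p \/ lt q p.
Proof. by rewrite mcoeff_neq0 => -[_]; apply. Qed.

Lemma tipI x p : x@_p != 0 -> (forall q, x@_q != 0 -> q = p \/ lt q p) ->
  is_tip lt x p.
Proof.
by rewrite mcoeff_neq0 => xp h; split=> // q; rewrite -mcoeff_neq0; apply: h.
Qed.

Lemma tip_addl x y p : is_tip lt x p ->
  (forall q, y@_q != 0 -> lt q p) -> is_tip lt (x + y) p.
Proof.
move=> xp yp.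
have yp0 : y@_p = 0.
  by apply/eqP/negPn/negP => /yp; rewrite (wo_irr lt_wo).
apply: tipI => [|q]; first by rewrite mcoeffD yp0 addr0 tip_neq0.
rewrite mcoeffD; have [->|/yp] := eqVneq y@_q 0; last by right.
by rewrite addr0; apply: tip_le.
Qed.

Lemma tip_lt_add x y p q : is_tip lt x p -> is_tip lt y q -> lt q p ->
  is_tip lt (x + y) p.
Proof.
move=> xp yq qp; apply: tip_addl => // r /(tip_le yq)[->//|rq].
exact: (wo_trans lt_wo) qp.
Qed.

(* Summands with distinct tips cannot cancel each other's leading terms. *)
Lemma sum_tip (S : eqType) (s : seq S) (F : S -> {malg k[K]}) :
  uniq s -> s != [::] -> (forall t, t \in s -> F t != 0) ->
  (forall t u p, t \in s -> u \in s ->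
     is_tip lt (F t) p -> is_tip lt (F u) p -> t = u) ->
  exists t p, [/\ t \in s, is_tip lt (F t) p, is_tip lt (\sum_(u <- s) F u) p &
    forall u q, u \in s -> is_tip lt (F u) q -> q = p \/ lt q p].
Proof.
elim: s => // x s IH /= /andP[xs us] _ F0 Finj.
have [p xp] := tip_exists (F0 x (mem_head _ _)).
have [->|s0] := eqVneq s [::].
  exists x, p; split; rewrite ?mem_head ?big_seq1 // => u q.
  by rewrite inE => /eqP -> xq; left; apply: tip_unique xp.
have [] := IH us s0.
- by move=> t ts; apply: F0; rewrite inE ts orbT.
- by move=> t u q ts us'; apply: Finj; rewrite inE ?ts ?us' orbT.
move=> t [q [ts tq sq qmax]]; rewrite big_cons.
have ts' : t \in x :: s by rewrite inE ts orbT.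
case/or3P: (wo_total lt_wo p q) => [/eqP pq|pq|qp].
- move: xs; rewrite (Finj x t p) ?mem_head ?ts //.
  by rewrite pq.
- exists t, q; split => //; first by rewrite addrC; apply: tip_lt_add sq xp pq.
  move=> u r; rewrite inE => /orP[/eqP->|/qmax]; last exact.
  by move=> xr; right; rewrite (tip_unique xr xp).
- exists x, p; split; rewrite ?mem_head //; first exact: tip_lt_add xp sq qp.
  move=> u r; rewrite inE => /orP[/eqP->|us' /(qmax _ _ us')].
    by move=> xr; left; apply: tip_unique xp.
  by case=> [->|rq]; right => //; apply: (wo_trans lt_wo) qp.
Qed.

End Tips.

(** * Prefixes of paths *)

Section PathDivision.
Variable Q : quiver.
Implicit Types p q r s t : qpath Q.

Lemma pmulE p q r : pmul p q = Some r <->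
  [/\ pterminus p = porigin q, porigin r = porigin p
    & parrows r = parrows p ++ parrows q].
Proof. by split=> [/eqP/pmulP|/pmulP/eqP]. Qed.

Lemma pmul_length p q r : pmul p q = Some r ->
  plength r = (plength p + plength q)%N.
Proof. by case/pmulE=> _ _ rE; rewrite /plength rE size_cat. Qed.

Lemma pmul_origin p q r : pmul p q = Some r -> porigin r = porigin p.
Proof. by case/pmulE. Qed.

(** Left divisibility becomes a prefix test on arrow sequences; origins are compared separately
    because a vertex has no arrows. The remaining arrows form a walk from the terminus of [p]. *)
Lemma pdvdlP p q :
  pdvdl p q <-> porigin p = porigin q /\ prefix (parrows p) (parrows q).
Proof.
split=> [[s /pmulE[_ -> ->]]|[pq /prefixP[s qE]]].
  by split=> //; apply: prefix_prefix.
have ws : is_walk (pterminus p) s.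
  by have := qpath_walk q; rewrite qE is_walk_cat -pq => /andP[].
by exists (@QPath Q (pterminus p, s) ws); apply/pmulE; split.
Qed.

Lemma pdvdl_refl p : pdvdl p p.
Proof. by apply/pdvdlP; rewrite prefix_refl. Qed.

Lemma pdvdl_trans p q r : pdvdl p q -> pdvdl q r -> pdvdl p r.
Proof.
move=> /pdvdlP[po pq] /pdvdlP[qo qr]; apply/pdvdlP.
by rewrite po; split=> //; apply: prefix_trans pq qr.
Qed.

Lemma pmul_dvdl p q r : pmul p q = Some r -> pdvdl p r.
Proof. by exists q. Qed.

Lemma pdvdl_comparable p q r : pdvdl p r -> pdvdl q r ->
  (plength p <= plength q)%N -> pdvdl p q.
Proof.
move=> /pdvdlP[po pr] /pdvdlP[qo qr] pq; apply/pdvdlP; split; first by rewrite po.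
rewrite prefixE; move: pr qr; rewrite !prefixE => /eqP pr /eqP qr.
by rewrite -qr take_takel // pr.
Qed.

Lemma pdvdl_total p q r : pdvdl p r -> pdvdl q r -> pdvdl p q \/ pdvdl q p.
Proof.
move=> pr qr; case: (leqP (plength p) (plength q)) => [|/ltnW] pq.
  by left; apply: (pdvdl_comparable pr qr).
by right; apply: (pdvdl_comparable qr pr).
Qed.

Lemma pmul_eq_length0 p q r : pmul p q = Some r -> plength q = 0%N -> r = p.
Proof.
move=> /pmulE[_ ro rE] /eqP; rewrite size_eq0 => /eqP q0.
by apply: qpath_eq => //; rewrite rE q0 cats0.
Qed.

Lemma pmul_injr p q q' r : pmul p q = Some r -> pmul p q' = Some r -> q = q'.
Proof.
move=> /pmulE[pq _ rE] /pmulE[pq' _ rE']; apply: qpath_eq; rewrite -?pq //.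
have /eqP : parrows p ++ parrows q = parrows p ++ parrows q' by rewrite -rE.
by rewrite eqseq_cat // eqxx => /eqP.
Qed.

End PathDivision.

(** * The right action of a ring on a module *)

Section RightAction.
Variables (R : pzRingType) (V : lmodType R^c).
Implicit Types (u v : V) (r s : R).

Lemma ractDl u v r : (u + v) :* r = u :* r + v :* r.
Proof. exact: scalerDr. Qed.

Lemma ractDr u r s : u :* (r + s) = u :* r + u :* s.
Proof. exact: scalerDl. Qed.

Lemma ractA u r s : u :* r :* s = u :* (r * s).
Proof. exact: scalerA. Qed.

Lemma ract0l r : (0 : V) :* r = 0.
Proof. exact: scaler0. Qed.

Lemma ract0r u : u :* 0 = 0.
Proof. exact: scale0r. Qed.

Lemma ract1 u : u :* 1 = u.
Proof. exact: scale1r. Qed.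

Lemma ractNl u r : (- u) :* r = - (u :* r).
Proof. exact: scalerN. Qed.

Lemma ractNr u r : u :* (- r) = - (u :* r).
Proof. exact: scaleNr. Qed.

Lemma ract_suml (T : Type) (s : seq T) (F : T -> V) r :
  (\sum_(i <- s) F i) :* r = \sum_(i <- s) F i :* r.
Proof. exact: scaler_sumr. Qed.

End RightAction.

(** * Sums of finitely supported families *)

Section DirectSums.
Variables (V : zmodType) (S : choiceType).
Implicit Types (x y : {malg V[S]}) (D : set S) (A : S -> set V).

Lemma msumw (d : {fset S}) x : (msupp x `<=` d)%fset ->
  msum x = \sum_(s <- d) x@_s.
Proof.
by move=> xd; apply: big_fset_incl => // s _ /mcoeff_outdom.
Qed.

Lemma msumD x y : msum (x + y) = msum x + msum y.
Proof.
rewrite (msumw (msuppD_le x y)) (msumw (fsubsetUl (msupp x) (msupp y))).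
rewrite (msumw (fsubsetUr (msupp x) (msupp y))) -big_split.
by apply: eq_bigr => s _; rewrite mcoeffD.
Qed.

Lemma msum0 : msum (0 : {malg V[S]}) = 0.
Proof. by rewrite /msum msupp0 big_seq_fset0. Qed.

Lemma msumN x : msum (- x) = - msum x.
Proof. by apply/eqP; rewrite -addr_eq0 -msumD addNr msum0. Qed.

Lemma msumB x y : msum (x - y) = msum x - msum y.
Proof. by rewrite msumD msumN. Qed.

Lemma msumU (v : V) (s : S) : msum << v *g s >> = v.
Proof. by rewrite (msumw (@msuppU_le _ _ s v)) big_seq_fset1 mcoeffUU. Qed.

(** When every [A s] contains 0, membership can be tested at all indices, and the support enters
    only through [D]. *)
Lemma family_inP D A x : (forall s, A s 0) ->
  family_in D A x <-> forall s, A s x@_s /\ (x@_s != 0 -> D s).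
Proof.
move=> A0; split=> [xA s|xA s]; last by rewrite -mcoeff_neq0 => xs; case: (xA s); split; auto.
have [xs|/mcoeff_outdom->] := boolP (s \in msupp x); last by rewrite eqxx.
by have [] := xA _ xs.
Qed.

End DirectSums.

(** * Families of multiples of given generators *)

Section CyclicFamilies.
Variables (R : pzRingType) (V : lmodType R^c) (S : choiceType) (D : set S).
Variable F : S -> V.
Local Notation fam := (family_in D (fun s => cyclic_submod setT (F s))).
Implicit Types (x y : {malg V[S]}) (r : R).

Lemma cyclicP x : fam x <->
  forall s, (exists r, x@_s = F s :* r) /\ (x@_s != 0 -> D s).
Proof.
rewrite family_inP => [|s]; last by exists 0; rewrite ?ract0r.
split=> xF s; case: (xF s) => xs xD; split=> //.
  by case: xs => r _ <-; exists r.
by case: xs => r ->; exists r.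
Qed.

Lemma fam0 : fam 0.
Proof.
apply/cyclicP => s; rewrite mcoeff0 eqxx; split=> //.
by exists 0; rewrite ract0r.
Qed.

Lemma famU s r : D s -> fam << F s :* r *g s >>.
Proof.
move=> Ds; apply/cyclicP => t; rewrite mcoeffU; case: eqP => [<-|_].
  by split=> //; exists r.
by rewrite eqxx; split=> //; exists 0; rewrite ract0r.
Qed.

Lemma famD x y : fam x -> fam y -> fam (x + y).
Proof.
move=> /cyclicP xF /cyclicP yF; apply/cyclicP => s; rewrite mcoeffD.
have [[[r xr] xD] [[r' yr] yD]] := (xF s, yF s); split.
  by exists (r + r'); rewrite xr yr ractDr.
have [->|/xD//] := eqVneq x@_s 0; rewrite add0r; exact: yD.
Qed.

(** Acting entrywise gives the family [y]; its support may shrink, so its sum is taken over the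
    support of [x]. *)
Lemma fam_ract x r : fam x ->
  exists2 y, fam y & msum y = msum x :* r.
Proof.
move=> /cyclicP xF; pose y := \sum_(s <- msupp x) << x@_s :* r *g s >>.
have yE s : y@_s = x@_s :* r.
  rewrite /y raddf_sum /=; have [sx|/mcoeff_outdom xs0] := boolP (s \in msupp x).
    rewrite (bigD1_seq s) ?fset_uniq //= mcoeffUU big1 ?addr0 // => t ts.
    by rewrite mcoeffU (negPf ts).
  rewrite xs0 ract0l big1 // => t _; rewrite mcoeffU; case: eqP => // ->.
  by rewrite xs0 ract0l.
have yx : (msupp y `<=` msupp x)%fset.
  apply/fsubsetP => s; rewrite -!mcoeff_neq0 yE; apply: contra_neq => ->.
  by rewrite ract0l.
exists y; last by rewrite (msumw yx) /msum ract_suml; apply: eq_bigr => s _.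
apply/cyclicP => s; rewrite yE; have [[r' xr] xD] := xF s; split.
  by exists (r' * r); rewrite xr ractA.
by move=> xs0; apply: xD; apply: contra_neq xs0 => ->; rewrite ract0l.
Qed.

Lemma famN x : fam x -> fam (- x).
Proof.
move=> /cyclicP xF; apply/cyclicP => s; rewrite mcoeffN oppr_eq0.
by have [[r xr] xD] := xF s; split=> //; exists (- r); rewrite xr ractNr.
Qed.

End CyclicFamilies.
(** * Tips in path algebras and their free modules *)

(* R stands for the path algebra, known only through its coefficient map cf, its
   scaling sc and its basis mon. *)
Section PathRing.
Variables (k : fieldType) (Q : quiver) (R : pzRingType).
Variables (cf : R -> {malg k[qpath Q]}) (sc : k -> R -> R) (mon : qpath Q -> R).
Hypothesis cf_inj : injective cf.
Hypothesis cfD : {morph cf : x y / x + y}.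
Hypothesis cf_mon : forall p, cf (mon p) = << p >>.
Hypothesis cf_sc : forall c x p, (cf (sc c x))@_p = c * (cf x)@_p.
Hypothesis cfM : forall x y s, (cf (x * y))@_s =
  \sum_(p <- msupp (cf x)) \sum_(q <- msupp (cf y))
    ((cf x)@_p * (cf y)@_q) *+ (pmul p q == Some s).
Implicit Types (p q : qpath Q) (v : qvert Q).

Let pv v := mon (vpath v).

Lemma cf0 : cf 0 = 0.
Proof. by apply: (addrI (cf 0)); rewrite -cfD !addr0. Qed.

Lemma cf_sum (S : Type) (l : seq S) (F : S -> R) :
  cf (\sum_(i <- l) F i) = \sum_(i <- l) cf (F i).
Proof. exact: (big_morph cf cfD cf0). Qed.

Lemma cf_neq0 x : x != 0 -> cf x != 0.
Proof. by apply: contra_neq => x0; apply: cf_inj; rewrite cf0. Qed.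

Lemma cf_ext x y : (forall p, (cf x)@_p = (cf y)@_p) -> x = y.
Proof. by move=> xy; apply/cf_inj/malgP. Qed.

(** * Coefficients of products *)

Lemma coef_mul_neq0 x y s : (cf (x * y))@_s != 0 ->
  exists p q, [/\ (cf x)@_p != 0, (cf y)@_q != 0 & pmul p q = Some s].
Proof.
have [//|h] := pselect (exists p q, [/\ (cf x)@_p != 0, (cf y)@_q != 0 & pmul p q = Some s]).
case/negP; apply/eqP; rewrite cfM big_seq big1 // => p px.
rewrite big_seq big1 // => q qy; case: eqP => // pqs; case: h.
by exists p, q; split => //; rewrite mcoeff_neq0.
Qed.

(** No cancellation is possible when only one pair of occurring paths can compose to [s]. The pair
    [(p, q)] may lie outside the supports, in which case both sides vanish. *)
Lemma coef_mul_unique x y p q s : pmul p q = Some s ->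
  (forall p' q', (cf x)@_p' != 0 -> (cf y)@_q' != 0 -> pmul p' q' = Some s ->
     p' = p /\ q' = q) ->
  (cf (x * y))@_s = (cf x)@_p * (cf y)@_q.
Proof.
move=> pqs u; have [xy0|xy0] := eqVneq ((cf x)@_p * (cf y)@_q) 0.
  apply/eqP; rewrite xy0; apply: contraTT isT => /coef_mul_neq0[p' [q' [xp yq e]]].
  have [pE qE] := u _ _ xp yq e.
  by move: xy0; rewrite -pE -qE => /eqP; rewrite mulf_eq0 (negPf xp) (negPf yq).
have /norP[xp yq] : ~~ (((cf x)@_p == 0) || ((cf y)@_q == 0)) by rewrite -mulf_eq0.
rewrite cfM (bigD1_seq p) ?fset_uniq //=; last by rewrite -mcoeff_neq0.
rewrite (bigD1_seq q) ?fset_uniq //=; last by rewrite -mcoeff_neq0.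
rewrite pqs eqxx mulr1n big1_seq; last first.
  move=> q' /andP[qq qy]; case: eqP => // e.
  have [_ qE] : p = p /\ q' = q by apply: u e => //; rewrite mcoeff_neq0.
  by rewrite qE eqxx in qq.
rewrite addr0 big1_seq ?addr0 // => p' /andP[pp px].
rewrite big1_seq // => q' /andP[_ qy]; case: eqP => // e.
have [pE _] : p' = p /\ q' = q by apply: u e; rewrite mcoeff_neq0 //.
by rewrite pE eqxx in pp.
Qed.

Lemma coef_pmon p q : (cf (mon p))@_q = (p == q)%:R.
Proof. by rewrite cf_mon mcoeffU. Qed.

Lemma coef_pmon_neq0 p q : (cf (mon p))@_q != 0 -> q = p.
Proof. by rewrite coef_pmon; case: (eqVneq p q) => // _; rewrite eqxx. Qed.

(** A path composes on the right with no vertex but its terminus, so a vertex acts as a projection;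
    right uniformity thereby becomes a condition on supports. *)
Lemma coef_mul_pvert x v p : (cf (x * pv v))@_p = (cf x)@_p *+ (pterminus p == v).
Proof.
case: (altP (pterminus p =P v)) => pV.
  rewrite (@coef_mul_unique _ _ p (vpath v)).
  - by rewrite coef_pmon eqxx mulr1.
  - by rewrite pmul_vr pV eqxx.
  - move=> p' q' _ /coef_pmon_neq0 ->; rewrite pmul_vr.
    by case: ifP => // _ [->].
apply/eqP; apply: contraTT pV => /coef_mul_neq0[p' [q' [_ /coef_pmon_neq0->]]].
by rewrite pmul_vr; case: ifP => // /eqP -> [->]; rewrite negbK.
Qed.

Lemma coef_pvert_mul x v p : (cf (pv v * x))@_p = (cf x)@_p *+ (porigin p == v).
Proof.
case: (altP (porigin p =P v)) => pV.
  rewrite (@coef_mul_unique _ _ (vpath v) p).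
  - by rewrite coef_pmon eqxx mul1r.
  - by rewrite pmul_vl pV eqxx.
  - move=> p' q' /coef_pmon_neq0 -> _; rewrite pmul_vl.
    by case: ifP => // _ [->].
apply/eqP; apply: contraTT pV => /coef_mul_neq0[p' [q' [/coef_pmon_neq0-> _]]].
by rewrite pmul_vl; case: ifP => // /eqP -> [->]; rewrite negbK.
Qed.

Lemma pvert_idem v : pv v * pv v = pv v.
Proof.
by apply: cf_ext => p; rewrite coef_mul_pvert coef_pmon; case: eqP => [<-|];
  rewrite ?eqxx ?mul0rn.
Qed.

Lemma terminus_supp x v p : x = x * pv v -> (cf x)@_p != 0 -> pterminus p = v.
Proof.
by move=> xv; rewrite xv coef_mul_pvert; case: (pterminus p =P v) => //; rewrite eqxx.
Qed.

Lemma origin_supp x v p : x = pv v * x -> (cf x)@_p != 0 -> porigin p = v.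
Proof.
by move=> xv; rewrite xv coef_pvert_mul; case: (porigin p =P v) => //; rewrite eqxx.
Qed.

Lemma pvert_mulP x v : (forall p, (cf x)@_p != 0 -> porigin p = v) ->
  pv v * x = x.
Proof.
move=> xv; apply: cf_ext => p; rewrite coef_pvert_mul.
have [->|/xv->] := eqVneq (cf x)@_p 0; first by rewrite mul0rn.
by rewrite eqxx.
Qed.

Lemma mul_pvertP x v : (forall p, (cf x)@_p != 0 -> pterminus p = v) ->
  x * pv v = x.
Proof.
move=> xv; apply: cf_ext => p; rewrite coef_mul_pvert.
have [->|/xv->] := eqVneq (cf x)@_p 0; first by rewrite mul0rn.
by rewrite eqxx.
Qed.

Lemma pvert_pmon p : pv (porigin p) * mon p = mon p.
Proof. by apply: pvert_mulP => q /coef_pmon_neq0->. Qed.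

Lemma pmon_pvert p : mon p * pv (pterminus p) = mon p.
Proof. by apply: mul_pvertP => q /coef_pmon_neq0->. Qed.

Lemma coef_mul_pmon p q x s : pmul p q = Some s -> (cf (mon p * x))@_s = (cf x)@_q.
Proof.
move=> pqs; rewrite (coef_mul_unique pqs) ?coef_pmon ?eqxx ?mul1r //.
move=> p' q' /coef_pmon_neq0-> _ pqs'; split=> //.
exact: pmul_injr pqs' pqs.
Qed.

(** * Admissible orders and tips of products *)

Variable lt : rel (qpath Q).
Hypothesis lt_adm : admissible lt.
Let lt_wo := adm_wo lt_adm.

(** Compare [p q] with [a q], then with [a b]. The intermediate product exists because [p] and [a]
    share a terminus, which right uniformity of the left factor will provide. *)
Lemma pmul_le p q a b s t : p = a \/ lt p a -> q = b \/ lt q b ->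
  pterminus p = pterminus a -> pmul a b = Some s -> pmul p q = Some t ->
  [/\ p = a, q = b & t = s] \/ lt t s.
Proof.
move=> pa qb tpa abs pqt; case: pa => [pa|pa].
  case: qb => [qb|qb]; last by right; apply: (adm_mull lt_adm qb abs); rewrite -pa.
  by left; split=> //; move: pqt; rewrite pa qb abs => -[].
right; have [u aqu] : exists u, pmul a q = Some u.
  by apply: pmul_comp; rewrite -tpa; case/pmulE: pqt.
have tu := adm_mulr lt_adm pa aqu pqt.
case: qb => [qb|qb]; first by move: aqu; rewrite qb abs => -[->].
exact: (wo_trans lt_wo) tu (adm_mull lt_adm qb abs aqu).
Qed.

(** By monotonicity every other pair of occurring paths has a product below [a b], so [s] arises
    only from [(a, b)]. *)
Lemma coef_mul_tip x y v a b s : x = x * pv v ->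
  (forall p, (cf x)@_p != 0 -> p = a \/ lt p a) -> pterminus a = v ->
  (forall q, (cf y)@_q != 0 -> q = b \/ lt q b) ->
  pmul a b = Some s -> (cf (x * y))@_s = (cf x)@_a * (cf y)@_b.
Proof.
move=> xv xa av yb abs; apply: coef_mul_unique => // p q xp yq pqs.
have := pmul_le (xa _ xp) (yb _ yq) _ abs pqs.
rewrite (terminus_supp xv xp) => /(_ (esym av))[[]//|].
by rewrite (wo_irr lt_wo).
Qed.

(** If [y] were nonzero, the tips would compose at [v] and give [x y] a nonzero coefficient. Thus
    left multiplication by [x] is injective on [v R]. *)
Lemma mul_eq0_uniform x y v : x != 0 -> x = x * pv v -> y = pv v * y ->
  x * y = 0 -> y = 0.
Proof.
move=> x0 xv yv xy; apply: contraTeq isT => y0.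
have [[a xa] [b yb]] := (tip_exists lt_wo (cf_neq0 x0), tip_exists lt_wo (cf_neq0 y0)).
have av := terminus_supp xv (tip_neq0 xa).
have bv := origin_supp yv (tip_neq0 yb).
have [s abs] : exists s, pmul a b = Some s by apply: pmul_comp; rewrite av.
have := coef_mul_tip xv (fun p => tip_le xa) av (fun p => tip_le yb) abs.
rewrite xy cf0 mcoeff0 => /esym/eqP; rewrite mulf_eq0.
by rewrite (negPf (tip_neq0 xa)) (negPf (tip_neq0 yb)).
Qed.

Definition tip_paths (X : set R) : set R :=
  [set t | exists x p, [/\ X x, is_tip lt (cf x) p & t = mon p]].

(* The span of the paths divisible by the tip of an element of G is an ideal. *)
Lemma grobner_tip_dvd (I G : set R) y p :
  ideal_generated (tip_paths G) = ideal_generated (tip_paths I) ->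
  I y ->
  is_tip lt (cf y) p -> exists g b, [/\ G g, is_tip lt (cf g) b & pdvd b p].
Proof.
move=> GI Iy yp.
pose J : set R := [set x | forall q, (cf x)@_q != 0 ->
  exists g b, [/\ G g, is_tip lt (cf g) b & pdvd b q]].
suff : J (mon p) by apply; rewrite coef_pmon eqxx oner_neq0.
have : ideal_generated (tip_paths G) (mon p).
  by rewrite GI => J' _; apply; exists y, p.
apply.
  split.
  - by move=> q; rewrite cf0 mcoeff0 eqxx.
  - move=> x z Jx Jz q; rewrite cfD mcoeffD; have [->|/Jx//] := eqVneq (cf x)@_q 0.
    by rewrite add0r => /Jz.
  - move=> z x Jx s /coef_mul_neq0[r [q [_ /Jx[g [b [Gg gb]]]]]].
    move=> [r1 [s1 [t1 [e1 e2]]]] rqs; exists g, b; split=> //.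
    have := pmulA r r1 b; have := pmulA r t1 s1; rewrite e1 e2 /= rqs.
    case e3: (pmul r t1) => [t2|] //= e4.
    case e5: (pmul r r1) => [r2|] //= e6.
    by exists r2, s1, t2.
  - move=> z x Jx s /coef_mul_neq0[q [r [/Jx[g [b [Gg gb]]]]]].
    move=> [r1 [s1 [t1 [e1 e2]]]] _ qrs; exists g, b; split=> //.
    have := pmulA t1 s1 r; rewrite e2 /= qrs.
    case e3: (pmul s1 r) => [s2|] //= e4.
    by exists r1, s2, t1.
move=> _ [g [b [Gg gb ->]]] q /coef_pmon_neq0->; exists g, b; split=> //.
exists (vpath (porigin b)), (vpath (pterminus b)), b.
by rewrite pmul_vl pmul_vr !eqxx.
Qed.

(** * Components of elements of [P] *)

Variables (T0 : choiceType) (lt0 : rel T0) (v0 : T0 -> qvert Q) (f0 : T0 -> R).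
Hypothesis lt0_wo : well_order lt0.
Hypothesis f0_uniform : forall i, f0 i != 0 /\ f0 i * pv (v0 i) = f0 i.
Local Notation P := (coprod f0).
Local Notation coord := (@Defs.coord _ _ f0).
Implicit Types (w u : P) (i j : T0).

Lemma coordD w u i : coord (w + u) i = coord w i + coord u i.
Proof. exact: (mcoeffD i (coprod_val w) (coprod_val u)). Qed.

Lemma coord0 i : coord (0 : P) i = 0.
Proof. exact: (mcoeff0 i). Qed.

Lemma coord_ract w (r : R) i : coord (w :* r) i = coord w i * r.
Proof. exact: (mcoeff_ract (coprod_val w)). Qed.

Lemma coord_eps i j : coord (eps f0 i) j = f0 i *+ (i == j).
Proof. exact: mcoeffU. Qed.

Lemma coord_inj w u : (forall i, coord w i = coord u i) -> w = u.
Proof. by move=> h; apply/val_inj/malgP. Qed.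

Lemma f0_inj i (r s : R) : pv (v0 i) * r = r -> pv (v0 i) * s = s ->
  f0 i * r = f0 i * s -> r = s.
Proof.
move=> vr vs rs; have [f00 fv] := f0_uniform i.
apply/subr0_eq/(mul_eq0_uniform f00 (esym fv)).
  by rewrite mulrBr vr vs.
by rewrite mulrBr rs subrr.
Qed.

(** Any preimage [r] may be replaced by [v_i r], which has the same product with [f0 i] and is the
    only representative in [v_i R]. *)
Lemma comp_subproof w i :
  exists r : R, pv (v0 i) * r = r /\ coord w i = f0 i * r.
Proof.
have [r wr] := asboolP _ (valP w) i.
exists (pv (v0 i) * r); split; first by rewrite mulrA pvert_idem.
by rewrite mulrA (proj2 (f0_uniform i)).
Qed.

(* The inverse image of the i-th coordinate under v_i R ~ f0_i R. *)
Definition comp w i : R := projT1 (cid (comp_subproof w i)).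

Lemma comp_left w i : pv (v0 i) * comp w i = comp w i.
Proof. by rewrite /comp; case: cid => r []. Qed.

Lemma coord_comp w i : coord w i = f0 i * comp w i.
Proof. by rewrite /comp; case: cid => r []. Qed.

Lemma comp_unique w i (r : R) : pv (v0 i) * r = r -> coord w i = f0 i * r ->
  comp w i = r.
Proof. by move=> vr; rewrite coord_comp; apply: f0_inj; rewrite ?comp_left. Qed.

Lemma compD w u i : comp (w + u) i = comp w i + comp u i.
Proof.
apply: comp_unique; first by rewrite mulrDr !comp_left.
by rewrite coordD !coord_comp mulrDr.
Qed.

Lemma comp0 i : comp 0 i = 0.
Proof. by apply: comp_unique; rewrite ?coord0 mulr0. Qed.

Lemma comp_sum (S : Type) (l : seq S) (F : S -> P) i :
  comp (\sum_(t <- l) F t) i = \sum_(t <- l) comp (F t) i.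
Proof.
by apply: (big_morph (comp^~ i)) => [u w|]; [apply: compD | apply: comp0].
Qed.

Lemma comp_ract w (r : R) i : comp (w :* r) i = comp w i * r.
Proof.
apply: comp_unique; first by rewrite mulrA comp_left.
by rewrite coord_ract coord_comp mulrA.
Qed.

Lemma comp_eps i (r : R) j : pv (v0 i) * r = r ->
  comp (eps f0 i :* r) j = r *+ (i == j).
Proof.
move=> vr; apply: comp_unique.
  by case: eqP => [<-//|_]; rewrite mulr0.
by rewrite coord_ract coord_eps; case: eqP => [<-//|_]; rewrite mulr0 mul0r.
Qed.

Lemma comp_inj w u : (forall i, comp w i = comp u i) -> w = u.
Proof. by move=> h; apply: coord_inj => i; rewrite !coord_comp h. Qed.

Lemma comp_outdom w i : i \notin msupp (coprod_val w) -> comp w i = 0.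
Proof.
move=> iw; apply: comp_unique; rewrite mulr0 //.
exact: (mcoeff_outdom iw).
Qed.

(** * Expansion in the basis of the [eps_i p] *)

Local Notation E := {malg k[(T0 * qpath Q)%type]}.

(** An explicit expansion read off the components; it is later identified with the chosen
    [expansion]. *)
Definition expand w : E :=
  \sum_(i <- msupp (coprod_val w)) \sum_(p <- msupp (cf (comp w i)))
    << (cf (comp w i))@_p *g (i, p) >>.

Lemma coef_expand w i p : (expand w)@_(i, p) = (cf (comp w i))@_p.
Proof.
rewrite /expand raddf_sum /=; have [iw|iw] := boolP (i \in msupp (coprod_val w)).
  rewrite (bigD1_seq i) ?fset_uniq //= [X in _ + X]big1 ?addr0 => [|j ji].
    rewrite [in RHS](monalgE (cf (comp w i))) !raddf_sum /=; apply: eq_bigr => q _.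
    by rewrite !mcoeffU xpair_eqE eqxx.
  rewrite raddf_sum big1 // => q _ /=.
  by rewrite mcoeffU xpair_eqE (negPf ji).
rewrite (comp_outdom iw) cf0 mcoeff0 big1_seq // => j /andP[_ jw].
rewrite raddf_sum big1 // => q _ /=; rewrite mcoeffU xpair_eqE.
by case: eqP => // ji; rewrite -ji jw in iw.
Qed.

(** Inverse to [expand] on functions supported on pairs [(i, p)] with [p] of origin [v0 i]; together
    the two maps show that the [eps_i p] form a basis. *)
Definition of_expansion (c : E) : P :=
  \sum_(e <- msupp c) eps f0 e.1 :* sc c@_e (mon e.2).

Lemma comp_of_expansion (c : E) i p :
  (forall e, e \in msupp c -> porigin e.2 = v0 e.1) ->
  (cf (comp (of_expansion c) i))@_p = c@_(i, p).
Proof.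
move=> co; rewrite comp_sum big_seq.
rewrite (eq_bigr (fun e => sc c@_e (mon e.2) *+ (e.1 == i))) => [|e /co xo].
  rewrite -big_seq cf_sum raddf_sum /= [in RHS](monalgE c) raddf_sum /=.
  apply: eq_bigr => -[j q] _; rewrite mcoeffU /= xpair_eqE.
  case: eqP => _ /=; last by rewrite cf0 mcoeff0.
  by rewrite cf_sc coef_pmon mulr_natr.
rewrite comp_eps //; apply: pvert_mulP => p'; rewrite cf_sc -xo.
by rewrite mulf_eq0 negb_or => /andP[_ /coef_pmon_neq0 ->].
Qed.

Lemma expand_origin w e : e \in msupp (expand w) -> porigin e.2 = v0 e.1.
Proof.
case: e => i p; rewrite -mcoeff_neq0 coef_expand; apply: origin_supp.
by rewrite comp_left.
Qed.

Lemma expandK w : of_expansion (expand w) = w.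
Proof.
apply: comp_inj => i; apply: cf_ext => p.
by rewrite comp_of_expansion ?coef_expand //; apply: expand_origin.
Qed.

Lemma expand_unique (c : E) : (forall e, e \in msupp c -> porigin e.2 = v0 e.1) ->
  expand (of_expansion c) = c.
Proof.
by move=> co; apply/malgP => -[i p]; rewrite coef_expand comp_of_expansion.
Qed.

Lemma expandD w u : expand (w + u) = expand w + expand u.
Proof.
by apply/malgP => -[i p]; rewrite mcoeffD !coef_expand compD cfD mcoeffD.
Qed.

Lemma expand0 : expand (0 : P) = 0.
Proof. by apply/malgP => -[i p]; rewrite coef_expand comp0 cf0 !mcoeff0. Qed.

Lemma expandN w : expand (- w) = - expand w.
Proof. by apply/eqP; rewrite -addr_eq0 -expandD addNr expand0. Qed.

Lemma expand_sum (S : Type) (l : seq S) (F : S -> P) :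
  expand (\sum_(t <- l) F t) = \sum_(t <- l) expand (F t).
Proof. exact: (big_morph _ expandD expand0). Qed.

Lemma expand_neq0 w : w != 0 -> expand w != 0.
Proof.
apply: contra_neq => w0; apply: comp_inj => i; apply: cf_ext => p.
by rewrite -!coef_expand w0 expand0.
Qed.

(** * Tips in [P] *)

Local Notation blt := (basis_lt lt lt0).

(** The order is lexicographic, path before coordinate: well-foundedness is an induction on the path
    with an inner induction on the coordinate. *)
Lemma basis_lt_wo : well_order blt.
Proof.
split.
- move=> [j q] [i p] [l r]; rewrite /basis_lt /=.
  case/orP=> [pq|/andP[/eqP-> ij]]; case/orP=> [qr|/andP[/eqP<- jl]].
  + by rewrite (wo_trans lt_wo pq qr).
  + by rewrite pq.
  + by rewrite qr.
  + by rewrite eqxx (wo_trans lt0_wo ij jl) orbT.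
- move=> [i p] [j q]; rewrite /basis_lt /= xpair_eqE.
  case/or3P: (wo_total lt_wo p q) => [/eqP->|->|->]; rewrite ?orbT //.
  by rewrite eqxx andbT; case/or3P: (wo_total lt0_wo i j) => ->; rewrite ?orbT.
- move=> [i p]; elim/(well_founded_ind (wo_wf lt_wo)): p i => p IHp i.
  elim/(well_founded_ind (wo_wf lt0_wo)): i => i IHi.
  constructor=> -[j q]; rewrite /basis_lt /=.
  by case/orP=> [/IHp|/andP[/eqP-> /IHi]].
Qed.

Definition tipP w i p : Prop := is_tip blt (expand w) (i, p).

Lemma tipP_exists w : w != 0 -> exists i p, tipP w i p.
Proof. by move=> /expand_neq0/(tip_exists basis_lt_wo)[[i p]]; exists i, p. Qed.

Lemma tipP_unique w i j p q : tipP w i p -> tipP w j q -> i = j /\ p = q.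
Proof. by move=> ip /(tip_unique basis_lt_wo ip)[]. Qed.

Lemma tipP_neq0 w i p : tipP w i p -> w != 0.
Proof. by move=> [+ _]; apply: contraTneq => ->; rewrite expand0 msupp0. Qed.

Lemma tipP_origin w i p : tipP w i p -> porigin p = v0 i.
Proof. by case=> /expand_origin. Qed.

Lemma tipP_coef w i p : tipP w i p -> (cf (comp w i))@_p != 0.
Proof. by move=> /tip_neq0; rewrite coef_expand. Qed.

Lemma tipP_le w i p j q : tipP w i p -> (cf (comp w j))@_q != 0 ->
  q = p \/ lt q p.
Proof.
move=> wp; rewrite -coef_expand => /(tip_le wp)[[_ ->]|]; first by left.
by rewrite /basis_lt /= => /orP[|/andP[/eqP]]; [right|left].
Qed.

Definition unif_vec w : Prop := w != 0 /\ exists v, w = w :* pv v.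

Lemma tipP_terminus w i p v : w = w :* pv v -> tipP w i p -> pterminus p = v.
Proof.
move=> wv /tipP_coef; apply: terminus_supp.
by rewrite -comp_ract -wv.
Qed.

Lemma tipP_mul w v (r : R) i a b s : w = w :* pv v -> tipP w i a ->
  r = pv v * r -> is_tip lt (cf r) b -> pmul a b = Some s ->
  tipP (w :* r) i s /\
  (cf (comp (w :* r) i))@_s = (cf (comp w i))@_a * (cf r)@_b.
Proof.
move=> wv wa vr rb abs; have av := tipP_terminus wv wa.
have cv j : comp w j = comp w j * pv v by rewrite -comp_ract -wv.
have cE : (cf (comp (w :* r) i))@_s = (cf (comp w i))@_a * (cf r)@_b.
  rewrite comp_ract; apply: (coef_mul_tip (cv i) _ av _ abs).
    by move=> p; apply: tipP_le wa.
  by move=> q; apply: tip_le rb.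
split; last exact: cE.
apply: tipI => [|[j t]].
  by rewrite coef_expand cE mulf_neq0 ?(tipP_coef wa) ?(tip_neq0 rb).
rewrite coef_expand comp_ract => /coef_mul_neq0[p [q [wp rq pqt]]].
have pv' := terminus_supp (cv j) wp.
have := pmul_le (tipP_le wa wp) (tip_le rb rq) _ abs pqt.
rewrite pv' av => /(_ erefl)[[pa _ ->]|ts]; last by right; rewrite /basis_lt /= ts.
(* A tie with [s] forces the left factor to be [a]; then [(j, a)] occurs in [w], and the tip of [w]
   settles the comparison of [j] with [i]. *)
move: wp; rewrite -coef_expand pa => /(tip_le wa)[[->]|]; first by left.
rewrite /basis_lt /= (wo_irr lt_wo) eqxx /= => ji.
by right; rewrite eqxx ji orbT.
Qed.

Lemma ract_pv w v (r : R) : w = w :* pv v -> w :* r = w :* (pv v * r).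
Proof. by move=> wv; rewrite -ractA -wv. Qed.

(** Since [w = w v], the factor [r] may be replaced by [v r], which is nonzero with a tip composable
    with [a]; the product rule for tips applies. *)
Lemma tipP_cyclic w (r : R) i j a t : unif_vec w -> tipP w i a -> tipP (w :* r) j t ->
  i = j /\ pdvdl a t.
Proof.
move=> [_ [v wv]] wa; rewrite (ract_pv r wv); set y := pv v * r => wt.
have y0 : y != 0.
  by apply: contraTneq (tipP_neq0 wt) => ->; rewrite ract0r eqxx.
have vy : y = pv v * y by rewrite /y mulrA pvert_idem.
have [b yb] := tip_exists lt_wo (cf_neq0 y0).
have [s abs] : exists s, pmul a b = Some s.
  apply: pmul_comp; rewrite (tipP_terminus wv wa).
  by rewrite (origin_supp vy (tip_neq0 yb)).
have [ws _] := tipP_mul wv wa vy yb abs.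
by have [-> <-] := tipP_unique ws wt; split=> //; exists b.
Qed.

Definition sum_dom (S1 S2 : Type) (D1 : set S1) (D2 : set S2) : set (S1 + S2) :=
  fun s => match s with inl s1 => D1 s1 | inr s2 => D2 s2 end.

Definition sum_fam (S1 S2 U : Type) (F1 : S1 -> U) (F2 : S2 -> U) (s : S1 + S2) : U :=
  match s with inl s1 => F1 s1 | inr s2 => F2 s2 end.

(** Tip-reducedness for indexed families: it concludes equality of indices, so repetitions of a
    nonzero generator are excluded as well. *)
Definition tip_free (S : Type) (D : set S) (F : S -> P) : Prop :=
  forall s t i p q, D s -> D t -> tipP (F s) i p -> tipP (F t) i q ->
    pdvdl p q -> s = t.

Lemma tipP_sub w u i q : tipP w i q -> tipP u i q ->
  (expand w)@_(i, q) = (expand u)@_(i, q) ->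
  forall e, (expand (w - u))@_e != 0 -> blt e (i, q).
Proof.
move=> wq uq wu e; rewrite expandD expandN mcoeffB => e0.
have [ee|eiq] := eqVneq e (i, q); first by rewrite ee wu subrr eqxx in e0.
have [w0|w0] := eqVneq (expand w)@_e 0; last first.
  by case: (tip_le wq w0) => [ee|//]; rewrite ee eqxx in eiq.
have u0 : (expand u)@_e != 0.
  by apply: contra_neq e0 => u0; rewrite w0 u0 subrr.
by case: (tip_le uq u0) => [ee|//]; rewrite ee eqxx in eiq.
Qed.

Lemma sc_mon c p : c != 0 ->
  is_tip lt (cf (sc c (mon p))) p /\ (cf (sc c (mon p)))@_p = c.
Proof.
move=> c0; have cp : (cf (sc c (mon p)))@_p = c.
  by rewrite cf_sc coef_pmon eqxx mulr1.
split=> //; apply: tipI => [|q]; first by rewrite cp.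
by rewrite cf_sc mulf_eq0 negb_or => /andP[_ /coef_pmon_neq0->]; left.
Qed.

Lemma pv_sc c x v : x = pv v * x -> sc c x = pv v * sc c x.
Proof.
move=> xv; symmetry; apply: pvert_mulP => p; rewrite cf_sc.
by rewrite mulf_eq0 negb_or => /andP[_]; apply: origin_supp xv.
Qed.

(** * Direct sums generated by two families with incomparable tips *)

Section TwoFamilies.
Variables (S1 S2 : choiceType) (D1 : set S1) (D2 : set S2).
Variables (F1 : S1 -> P) (F2 : S2 -> P).
Local Notation D := (sum_dom D1 D2).
Local Notation F := (sum_fam F1 F2).
Local Notation fam1 := (family_in D1 (fun s => cyclic_submod setT (F1 s))).
Local Notation fam2 := (family_in D2 (fun s => cyclic_submod setT (F2 s))).
Hypothesis F_uniform : forall s, D s -> unif_vec (F s).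
Hypothesis F_free : tip_free D F.

Definition sum_val (x : {malg P[S1]}) (y : {malg P[S2]}) (s : S1 + S2) : P :=
  match s with inl s1 => x@_s1 | inr s2 => y@_s2 end.

(** Were the tips of two summands equal, the tips of their generators would be prefixes of one path,
    hence comparable, against [F_free]. So leading terms do not cancel; the last clause bounds every
    summand by the tip of the whole sum. *)
Lemma tipP_msum x y : fam1 x -> fam2 y -> x != 0 \/ y != 0 ->
  exists s i p, [/\ D s, sum_val x y s != 0, tipP (sum_val x y s) i p,
    tipP (msum x + msum y) i p & forall t e, sum_val x y t != 0 ->
      is_tip blt (expand (sum_val x y t)) e -> e = (i, p) \/ blt e (i, p)].
Proof.
move=> /cyclicP xF /cyclicP yF xy0.
pose l : seq (S1 + S2) := map inl (msupp x) ++ map inr (msupp y).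
have lP s : (s \in l) = (sum_val x y s != 0).
  rewrite /l mem_cat; case: s => s /=; rewrite mcoeff_neq0.
    rewrite mem_map ?orbF; last by move=> ? ? [].
    by rewrite orbC; case: mapP => // -[].
  rewrite orbC mem_map ?orbF; last by move=> ? ? [].
  by rewrite orbC; case: mapP => // -[].
have lF s : s \in l -> D s /\ exists r, sum_val x y s = F s :* r.
  rewrite lP; case: s => s /= s0; first by have [xr /(_ s0)] := xF s.
  by have [yr /(_ s0)] := yF s.
have lsum : \sum_(s <- l) sum_val x y s = msum x + msum y.
  by rewrite /l big_cat !big_map.
have [] := @sum_tip _ _ _ basis_lt_wo _ l (fun s => expand (sum_val x y s)).
- rewrite cat_uniq !map_inj_uniq ?fset_uniq ?andbT /=; try by move=> ? ? [].
  by apply/hasPn => s /mapP[s2 _ ->]; apply/mapP => -[].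
- case: xy0 => [] /eqP z0; apply/eqP => l0; case: z0; apply/malgP => s;
    rewrite mcoeff0; apply/eqP.
    by have := lP (inl s); rewrite l0 in_nil => /esym/negPn.
  by have := lP (inr s); rewrite l0 in_nil => /esym/negPn.
- by move=> s; rewrite lP; apply: expand_neq0.
- move=> s t [i p] /lF[Ds [r ->]] /lF[Dt [r' ->]] sp tp.
  have [us ut] := (F_uniform Ds, F_uniform Dt).
  have [j [a sa]] := tipP_exists (proj1 us).
  have [j' [b tb]] := tipP_exists (proj1 ut).
  have [ji ap] := tipP_cyclic us sa sp; have [ji' bp] := tipP_cyclic ut tb tp.
  rewrite ji in sa; rewrite ji' in tb.
  case: (pdvdl_total ap bp) => [ab|ba]; first exact: F_free sa tb ab.
  by symmetry; apply: F_free tb sa ba.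
move=> s [[i p] [sl sp sump pmax]].
exists s, i, p; split; first by have [] := lF _ sl.
- by rewrite -lP.
- exact: sp.
- by rewrite /tipP -lsum expand_sum.
- by move=> t e; rewrite -lP; apply: pmax.
Qed.

Lemma tipP_msum_dvd x y : fam1 x -> fam2 y -> x != 0 \/ y != 0 ->
  exists s i a p, [/\ D s, sum_val x y s != 0, tipP (F s) i a,
    tipP (msum x + msum y) i p & pdvdl a p].
Proof.
move=> xF yF xy0; have [s [i [p [Ds s0 sp sump _]]]] := tipP_msum xF yF xy0.
have [r sr] : exists r, sum_val x y s = F s :* r.
  move/cyclicP: xF => xF; move/cyclicP: yF => yF.
  by case: s {Ds s0 sp} => s /=; [case: (xF s)|case: (yF s)].
have us := F_uniform Ds; have [j [a sa]] := tipP_exists (proj1 us).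
rewrite sr in sp; have [ji ap] := tipP_cyclic us sa sp.
by exists s, i, a, p; rewrite -ji in sump *.
Qed.

Lemma msum_direct x y : fam1 x -> fam2 y -> msum x + msum y = 0 ->
  x = 0 /\ y = 0.
Proof.
move=> xF yF xy0; have [[->]|] := pselect (x = 0 /\ y = 0); first by split.
move=> nxy; have /(tipP_msum xF yF)[s [i [p [_ _ _]]]] : x != 0 \/ y != 0.
  have [x0|] := eqVneq x 0; last by left.
  by right; apply/eqP => y0; case: nxy.
by rewrite xy0 => /tipP_neq0; rewrite eqxx.
Qed.

Lemma sum_fam_cyclic s (r : R) x y : D s -> fam1 x -> fam2 y ->
  exists x' y', [/\ fam1 x', fam2 y' &
    F s :* r + (msum x + msum y) = msum x' + msum y'].
Proof.
case: s => s /= Ds xF yF.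
  exists (<< F1 s :* r *g s >> + x), y; split=> //; first by apply: famD xF; apply: famU.
  by rewrite msumD msumU addrA.
exists x, (<< F2 s :* r *g s >> + y); split=> //; first by apply: famD yF; apply: famU.
by rewrite msumD msumU addrCA.
Qed.

Variable N : set P.
Hypothesis N0 : N 0.
Hypothesis NB : forall u w, N u -> N w -> N (u - w).
Hypothesis Nract : forall u (r : R), N u -> N (u :* r).
Hypothesis NF : forall s, D s -> N (F s).
Hypothesis N_grobner : forall w i q, N w -> tipP w i q ->
  exists s p, [/\ D s, tipP (F s) i p & pdvdl p q].

Lemma grobner_span w : N w ->
  exists x y, [/\ fam1 x, fam2 y & w = msum x + msum y].
Proof.
have [->|] := eqVneq w 0.
  by exists 0, 0; split; [exact: fam0|exact: fam0|rewrite !msum0 addr0].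
move=> /tipP_exists[i [q]]; move: w; rewrite /tipP; move: (i, q).
elim/(well_founded_ind (wo_wf basis_lt_wo)) => {i q} -[i q] IH w wq Nw.
have [s [p [Ds sp [t ptq]]]] := N_grobner Nw wq.
have us := F_uniform Ds; have [v sv] := proj2 us.
have vt : pterminus p = porigin t by case/pmulE: ptq.
have pvv := tipP_terminus sv sp.
have a0 := tipP_coef sp; have b0 := tipP_coef wq.
(* This scalar gives [F s] times [c t] the same leading coefficient as [w], so subtracting it lowers
   the tip. *)
set c := (cf (comp w i))@_q / (cf (comp (F s) i))@_p.
have c0 : c != 0 by rewrite mulf_neq0 ?invr_eq0.
have [ct cE] := sc_mon t c0.
have tv : sc c (mon t) = pv v * sc c (mon t).
  by apply: pv_sc; rewrite -pvv vt pvert_pmon.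
have [uq uE] := tipP_mul sv sp tv ct ptq.
set u := F s :* sc c (mon t) in uq uE.
have uw : (expand w)@_(i, q) = (expand u)@_(i, q).
  by rewrite !coef_expand uE cE /c mulrC divfK.
have [x [y [xF yF wE]]] : exists x y, [/\ fam1 x, fam2 y & w - u = msum x + msum y].
  have [->|] := eqVneq (w - u) 0.
    by exists 0, 0; split; [exact: fam0|exact: fam0|rewrite !msum0 addr0].
  move=> /tipP_exists[j [q' wuq]].
  apply: (IH _ _ _ wuq); first exact: (tipP_sub wq uq uw (tip_neq0 wuq)).
  exact: NB Nw (Nract _ (NF Ds)).
rewrite -(subrK u w) wE addrC; exact: sum_fam_cyclic.
Qed.

Lemma grobner_dsum : internal_dsum2 N D1 (fun s => cyclic_submod setT (F1 s))
  D2 (fun s => cyclic_submod setT (F2 s)).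
Proof.
have ND u w : N u -> N w -> N (u + w).
  by move=> Nu Nw; rewrite -[w]opprK; apply: NB => //; rewrite -[- w]add0r; apply: NB.
split=> [w|x y xF yF]; last exact: msum_direct.
split=> [|[x [y [xF yF ->]]]]; first exact: grobner_span.
apply: (ND); rewrite /msum big_seq; apply: (big_ind N N0 ND) => s.
  by case/xF=> Ds [r _ <-]; apply: Nract; apply: (NF (s := inl s)).
by case/yF=> Ds [r _ <-]; apply: Nract; apply: (NF (s := inr s)).
Qed.

End TwoFamilies.

(** * The construction of f2 *)

Hypothesis sc_mull : forall c x y, sc c (x * y) = sc c x * y.
Variables (I G : set R).
Hypothesis I_ideal : two_sided_ideal I.
Hypothesis G_sub : G `<=` I.
Hypothesis G_tips : ideal_generated (tip_paths G) = ideal_generated (tip_paths I).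
Hypothesis G_uniform : forall g, G g -> g != 0 /\ exists v' v, g = pv v' * g * pv v.

Definition ends_in (q : qpath Q) (g : R) (q' : qpath Q) : Prop :=
  G g /\ exists2 b, is_tip lt (cf g) b & pmul q' b = Some q.

Definition inner_free (q : qpath Q) : Prop :=
  forall g b r s t, G g -> is_tip lt (cf g) b ->
    pmul r b = Some t -> pmul t s = Some q -> plength s = 0%N.

Definition X_set p : set (qpath Q) :=
  [set q | [/\ pdvdl p q, exists g q', ends_in q g q' & inner_free q]].

Definition O_set p : set (qpath Q) :=
  [set q | X_set p q /\
    exists g q', ends_in q g q' /\ (plength q' < plength p)%N].

(** Induction on length: if some tip occurs ending before the end of [q], the prefix stopping there
    is shorter and still contains a tip; otherwise the given occurrence ends [q]. *)
Lemma shortest_prefix q g b : G g -> is_tip lt (cf g) b -> pdvd b q ->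
  exists q0, [/\ pdvdl q0 q, exists g q', ends_in q0 g q' & inner_free q0].
Proof.
have [n] := ubnP (plength q); elim: n q g b => // n IH q g b nq Gg gb.
move=> [r [s [t [rbt tsq]]]].
have [qf|nqf] := pselect (inner_free q).
  exists t; have s0 := qf _ _ _ _ _ Gg gb rbt tsq.
  rewrite -(pmul_eq_length0 tsq s0); split=> //; first exact: pdvdl_refl.
  exists g, r; split=> //; exists b => //.
  by rewrite (pmul_eq_length0 tsq s0).
have [g' [b' [r' [s' [t' [Gg' gb' rbt' tsq' s'0]]]]]] :
    exists g' b' r' s' t', [/\ G g', is_tip lt (cf g') b', pmul r' b' = Some t',
      pmul t' s' = Some q & plength s' <> 0%N].
  apply: contrapT => h; apply: nqf => g' b' r' s' t' h1 h2 h3 h4.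
  by apply: contrapT => h5; apply: h; exists g', b', r', s', t'.
have tq : (plength t' < n)%N.
  rewrite -ltnS; apply: leq_trans nq; rewrite ltnS (pmul_length tsq').
  by rewrite -addn1 leq_add2l lt0n; apply/eqP.
have [|q0 [q0t q0e q0f]] := IH t' g' b' tq Gg' gb'.
  exists r', (vpath (pterminus t')), t'; split=> //.
  by rewrite pmul_vr eqxx.
by exists q0; split=> //; apply: pdvdl_trans q0t (pmul_dvdl tsq').
Qed.

(** * Elements with all components in the ideal *)

Lemma ideal_comp w : coprod_ideal I w <-> forall i, I (comp w i).
Proof.
split=> wI i; last by exists (comp w i) => //; apply: coord_comp.
have [r Ir wr] := wI i; rewrite (@comp_unique w i (pv (v0 i) * r)).
- exact: (idealMl I_ideal).
- by rewrite mulrA pvert_idem.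
- by rewrite mulrA (proj2 (f0_uniform i)).
Qed.

Lemma coprod_idealD w u :
  coprod_ideal I w -> coprod_ideal I u -> coprod_ideal I (w + u).
Proof.
move=> /ideal_comp wI /ideal_comp uI; apply/ideal_comp => i.
by rewrite compD; apply: (idealD I_ideal).
Qed.

Lemma coprod_ideal0 : coprod_ideal I (0 : P).
Proof. by apply/ideal_comp => i; rewrite comp0; apply: (ideal0 I_ideal). Qed.

Lemma coprod_ideal_ract w (r : R) : coprod_ideal I w -> coprod_ideal I (w :* r).
Proof.
move=> /ideal_comp wI; apply/ideal_comp => i.
by rewrite comp_ract; exact: (Defs.idealMr I_ideal _ (wI i)).
Qed.

Lemma coprod_idealN w : coprod_ideal I w -> coprod_ideal I (- w).
Proof. by move=> wI; rewrite -[w]ract1 -ractNr; apply: coprod_ideal_ract. Qed.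

Lemma ract_ideal w (r : R) : I r -> coprod_ideal I (w :* r).
Proof.
by move=> Ir; apply/ideal_comp => i; rewrite comp_ract; apply: (idealMl I_ideal).
Qed.

Lemma sum_comp w :
  w = \sum_(i <- msupp (coprod_val w)) eps f0 i :* comp w i.
Proof.
apply: comp_inj => j; rewrite comp_sum.
rewrite (eq_bigr (fun i => comp w i *+ (i == j))) => [|i _]; last first.
  by rewrite comp_eps ?comp_left.
have [jw|jw] := boolP (j \in msupp (coprod_val w)).
  rewrite (bigD1_seq j) ?fset_uniq //= eqxx big1 ?addr0 // => i ij.
  by rewrite (negPf ij).
rewrite comp_outdom // big1_seq // => i /andP[_ iw].
by case: eqP => // ij; rewrite -ij iw in jw.
Qed.

Lemma tip_mon_mul q' g b q : is_tip lt (cf g) b -> pmul q' b = Some q ->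
  is_tip lt (cf (mon q' * g)) q /\ (cf (mon q' * g))@_q = (cf g)@_b.
Proof.
move=> gb q'b; have qE := coef_mul_pmon g q'b.
split=> //; apply: tipI => [|t]; first by rewrite qE (tip_neq0 gb).
case/coef_mul_neq0=> p [r [/coef_pmon_neq0-> gr q'r]].
case: (tip_le gb gr) => [rb|rb]; last by right; apply: (adm_mull lt_adm rb q'b q'r).
by left; move: q'r; rewrite rb q'b => -[].
Qed.

Lemma tip_sc c x p : c != 0 -> is_tip lt (cf x) p -> is_tip lt (cf (sc c x)) p.
Proof.
move=> c0 xp; apply: tipI => [|q].
  by rewrite cf_sc mulf_neq0 ?(tip_neq0 xp).
by rewrite cf_sc mulf_eq0 negb_or => /andP[_]; apply: (tip_le xp).
Qed.

Lemma pv_mon_mul q' g : mon q' * g = pv (porigin q') * (mon q' * g).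
Proof. by rewrite mulrA pvert_pmon. Qed.

Lemma tipP_eps i c q' g b q : c != 0 -> porigin q' = v0 i ->
  is_tip lt (cf g) b -> pmul q' b = Some q ->
  tipP (eps f0 i :* sc c (mon q' * g)) i q /\
  (expand (eps f0 i :* sc c (mon q' * g)))@_(i, q) = c * (cf g)@_b.
Proof.
move=> c0 qi gb q'b; have [xq qE] := tip_mon_mul gb q'b.
have vx : pv (v0 i) * sc c (mon q' * g) = sc c (mon q' * g).
  by symmetry; apply: pv_sc; rewrite -qi -pv_mon_mul.
have cE j : comp (eps f0 i :* sc c (mon q' * g)) j = sc c (mon q' * g) *+ (i == j).
  exact: comp_eps.
have eE : (expand (eps f0 i :* sc c (mon q' * g)))@_(i, q) = c * (cf g)@_b.
  by rewrite coef_expand cE eqxx cf_sc qE.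
split=> //; apply: tipI => [|[j t]].
  by rewrite eE mulf_neq0 ?(tip_neq0 gb).
rewrite coef_expand cE; case: (i =P j) => [<-|_]; last by rewrite cf0 mcoeff0 eqxx.
move=> /(tip_le (tip_sc c0 xq))[->|tq]; first by left.
by right; rewrite /basis_lt /= tq.
Qed.

(** * The presentation of [M] and the tips of its kernel *)

Variables (Lam : pzRingType) (quo : {rmorphism R -> Lam}) (M : lmodType Lam^c).
Hypothesis quo_ker : forall x, quo x = 0 <-> I x.
Variables (T1 U1 : choiceType) (f1 : T1 -> P) (f1' : U1 -> P).
Hypothesis f1_uniform : forall l, unif_vec (f1 l).
Hypothesis f1'_uniform : forall l, unif_vec (f1' l).
Hypothesis f1'_ideal : forall l, coprod_ideal I (f1' l).
Hypothesis f1_reduced : forall w u i j p q,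
  (range f1 `|` range f1') w -> (range f1 `|` range f1') u ->
  tipP w i p -> tipP u j q -> left_divides (i, p) (j, q) -> w = u.
Variable pi : {additive P -> M}.
Hypothesis pi_linear : forall w (r : R), pi (w :* r) = pi w :* quo r.
Hypothesis pi_exact : internal_dsum2 [set w | pi w = 0]
  setT (fun l => cyclic_submod setT (f1 l))
  setT (fun l => cyclic_submod setT (f1' l)).

Local Notation F1 := (sum_fam f1 f1').
Local Notation D1 := (sum_dom (@setT T1) (@setT U1)).
Local Notation fam1 := (family_in setT (fun l => cyclic_submod setT (f1 l))).
Local Notation fam1' := (family_in setT (fun l => cyclic_submod setT (f1' l))).

(** [w] is a combination of the [eps_i] with coefficients in [I], and [I] acts as zero on [M]
    through [quo]. *)
Lemma pi_ideal w : coprod_ideal I w -> pi w = 0.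
Proof.
move=> /ideal_comp wI; rewrite (sum_comp w) raddf_sum big1 // => i _ /=.
rewrite pi_linear; have -> : quo (comp w i) = 0 by apply/quo_ker.
exact: ract0r.
Qed.

Lemma pi_f1 l : pi (f1 l) = 0.
Proof.
apply/(proj1 pi_exact (f1 l)); exists << f1 l :* 1 *g l >>, 0.
split; [exact: famU|exact: fam0|by rewrite msumU msum0 addr0 ract1].
Qed.

(** [f1_reduced] identifies only elements; directness of the kernel recovers the index. Each
    generator is the sum of a one-entry family, and equal sums force equal families. *)
Lemma first_gens_inj s t : F1 s = F1 t -> s = t.
Proof.
pose X (s : T1 + U1) : {malg P[T1]} := if s is inl a then << f1 a :* 1 *g a >> else 0.
pose Y (s : T1 + U1) : {malg P[U1]} := if s is inr b then << f1' b :* 1 *g b >> else 0.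
have XF a : fam1 (X a) by case: a => a; [exact: famU|exact: fam0].
have YF a : fam1' (Y a) by case: a => a; [exact: fam0|exact: famU].
have XY a : msum (X a) + msum (Y a) = F1 a.
  by case: a => a /=; rewrite msumU msum0 ract1 ?addr0 ?add0r.
rewrite -!XY => /eqP; rewrite -subr_eq0 opprD addrACA -!msumB => /eqP.
case/(proj2 pi_exact); [exact: famD (famN _)|exact: famD (famN _)|].
move=> /subr0_eq Xst /subr0_eq Yst; case: s t Xst Yst => [a|a] [b|b] /=.
- move=> /malgP/(_ a) + _; rewrite mcoeffUU mcoeffU ract1; case: (b =P a) => [->//|_].
  by move=> a0; have := proj1 (f1_uniform a); rewrite a0 eqxx.
- move=> /malgP/(_ a) + _; rewrite mcoeffUU mcoeff0 ract1.
  by move=> a0; have := proj1 (f1_uniform a); rewrite a0 eqxx.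
- move=> _ /malgP/(_ a); rewrite mcoeffUU mcoeff0 ract1.
  by move=> a0; have := proj1 (f1'_uniform a); rewrite a0 eqxx.
- move=> _ /malgP/(_ a); rewrite mcoeffUU mcoeffU ract1; case: (b =P a) => [->//|_].
  by move=> a0; have := proj1 (f1'_uniform a); rewrite a0 eqxx.
Qed.

Lemma first_gens_uniform s : D1 s -> unif_vec (F1 s).
Proof. by case: s => s _; [apply: f1_uniform|apply: f1'_uniform]. Qed.

Lemma first_gens_free : tip_free D1 F1.
Proof.
have F1r s : (range f1 `|` range f1') (F1 s) by case: s => s; [left|right]; exists s.
move=> s t i p q _ _ sp tq pq; apply: first_gens_inj.
exact: (f1_reduced (F1r s) (F1r t) sp tq).
Qed.

Lemma kernel_tip w i q : pi w = 0 -> tipP w i q ->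
  exists s a, tipP (F1 s) i a /\ pdvdl a q.
Proof.
move=> w0 wq; have [x [y [xF yF wE]]] := proj1 (proj1 pi_exact w) w0.
have xy0 : x != 0 \/ y != 0.
  have [x0|] := eqVneq x 0; last by left.
  right; apply/eqP => y0; have := tipP_neq0 wq.
  by rewrite wE x0 y0 !msum0 addr0 eqxx.
have [s [j [a [p [_ _ sa wp ap]]]]] := tipP_msum_dvd first_gens_uniform first_gens_free xF yF xy0.
rewrite -wE in wp; have [ij qp] := tipP_unique wq wp.
by exists s, a; rewrite ij qp.
Qed.

(** * Tips in the intersection *)

Definition K : set P :=
  sum_of setT (fun l => cyclic_submod setT (f1 l)) `&` coprod_ideal I.

Lemma K_tip w i q : K w -> tipP w i q ->
  exists l a q0, [/\ tipP (f1 l) i a, X_set a q0 & pdvdl q0 q].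
Proof.
move=> [[x xF xw] wI] wq.
have x0 : x != 0.
  by apply: contraTneq (tipP_neq0 wq) => x0; rewrite -xw x0 msum0 eqxx.
have [s [j [a [p [_ + sa + ap]]]]] :=
  tipP_msum_dvd first_gens_uniform first_gens_free xF (fam0 _ _) (or_introl x0).
case: s sa => [l|b] /= la; last by rewrite mcoeff0 eqxx.
rewrite msum0 addr0 xw => _ wp; have [ij qp] := tipP_unique wq wp.
rewrite -{}ij -{}qp {j p} in la ap wp.
have Iq := proj1 (ideal_comp w) wI i.
have tq : is_tip lt (cf (comp w i)) q.
  apply: tipI => [|p wp']; first exact: tipP_coef wq.
  exact: tipP_le wq wp'.
have [g [b [Gg gb bq]]] := grobner_tip_dvd G_tips Iq tq.
have [q0 [q0q [g' [q' [Gg' [b' gb' q'b']]]] q0f]] := shortest_prefix Gg gb bq.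
exists l, a, q0; split=> //; split=> //; last by exists g', q'; split=> //; exists b'.
(* It remains that [a] is a prefix of [q0]. In the opposite case the kernel element [eps_i q' g']
   yields a generator whose tippath [a'] is a prefix of [q0], hence of [a]; incomparability forces
   [a' = a]. *)
case: (pdvdl_total ap q0q) => // q0a.
have q'i : porigin q' = v0 i.
  by rewrite -(pmul_origin q'b') -(tipP_origin la); case/pdvdlP: q0a.
have [uq _] := tipP_eps (oner_neq0 k) q'i gb' q'b'.
have uI : pi (eps f0 i :* sc 1 (mon q' * g')) = 0.
  apply/pi_ideal/ract_ideal; rewrite sc_mull.
  exact: (idealMl I_ideal) (G_sub Gg').
have [s [a' [sa' a'q0]]] := kernel_tip uI uq.
have sl : s = inl l.
  apply: (@first_gens_free s (inl l) i a' a) => [||||];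
    [by case: (s)|by []|exact: sa'|exact: la|exact: pdvdl_trans q0a].
by move: sa'; rewrite sl /= => /(tipP_unique la)[_ ->].
Qed.

(** * The element attached to one index *)

Definition f2P (s : T1 * qpath Q) (y : P) : Prop :=
  exists istar a g b q' p (x : {malg P[T1]}) (x' : {malg P[U1]}),
    [/\ tipP (f1 s.1) istar a,
        [/\ G g, is_tip lt (cf g) b & pmul q' b = Some s.2],
        pmul a p = Some s.2,
        [/\ fam1 x, fam1' x' &
            let c := (expand (f1 s.1))@_(istar, a) / (cf g)@_b in
            f1 s.1 :* mon p - eps f0 istar :* sc c (mon q' * g)
              = msum x + msum x'] &
        y = f1 s.1 :* mon p - msum x].

Definition f2'P (s : T1 * qpath Q) (y : P) : Prop :=
  exists istar a g q' z,
    [/\ tipP (f1 s.1) istar a, ends_in s.2 g q',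
        pmul a z = Some q' & y = f1 s.1 :* (mon z * g)].

Definition T2_set : set (T1 * qpath Q) :=
  [set s | exists i a, tipP (f1 s.1) i a /\ O_set a s.2].

Definition U2_set : set (T1 * qpath Q) :=
  [set s | exists i a, tipP (f1 s.1) i a /\ (X_set a `\` O_set a) s.2].

Lemma f1_ract_ideal l (r : R) : I r -> K (f1 l :* r).
Proof.
move=> Ir; split; last exact: ract_ideal.
by exists << f1 l :* r *g l >>; [apply: famU|rewrite msumU].
Qed.

Lemma f2P_exists s : T2_set s -> exists y, f2P s y.
Proof.
move=> [i [a [sa [[[p ap] [g [q' [Gg [b gb q'b]]]] _] _]]]].
set c := (expand (f1 s.1))@_(i, a) / (cf g)@_b.
pose w := f1 s.1 :* mon p - eps f0 i :* sc c (mon q' * g).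
have piw : pi w = 0.
  rewrite raddfB pi_linear pi_f1 ract0l pi_ideal ?subrr //.
  apply: ract_ideal; rewrite sc_mull.
  exact: (idealMl I_ideal) (G_sub Gg).
have [x [y [xF yF wE]]] := proj1 (proj1 pi_exact w) piw.
by exists (f1 s.1 :* mon p - msum x), i, a, g, b, q', p, x, y.
Qed.

Lemma f2'P_exists s : U2_set s -> exists y, f2'P s y.
Proof.
move=> [i [a [sa [[as2 [g [q' gq']] sf] nO]]]].
(* Outside [O_set] the end relation starts no earlier than the end of [a], so [q' = a z]. *)
have aq' : pdvdl a q'.
  have [b _ q'b] := proj2 gq'.
  apply: (pdvdl_comparable as2 (pmul_dvdl q'b)); rewrite leqNgt; apply/negP => q'a.
  by apply: nO; split; [split=> //; exists g, q'|exists g, q'].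
have [z az] := aq'.
by exists (f1 s.1 :* (mon z * g)), i, a, g, q', z.
Qed.

Lemma f2P_prop s y i a : tipP (f1 s.1) i a -> f2P s y ->
  [/\ tipP y i s.2, unif_vec y & K y].
Proof.
move=> sa [i' [a' [g [b [q' [p [x [x']]]]]]]].
case=> sa' [Gg gb q'b] ap [xF xF' /=].
have [ii' aa'] := tipP_unique sa' sa; subst i' a'.
set c := _ / _ => wE yE.
have [_ [v sv]] := f1_uniform s.1.
have av := tipP_terminus sv sa.
have pvp : mon p = pv v * mon p.
  by rewrite -av; case/pmulE: ap => -> _ _; rewrite pvert_pmon.
have pp : is_tip lt (cf (mon p)) p.
  apply: tipI => [|q /coef_pmon_neq0]; last by left.
  by rewrite coef_pmon eqxx oner_neq0.
have [t1 e1] := tipP_mul sv sa pvp pp ap.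
have a0 : (expand (f1 s.1))@_(i, a) != 0 by rewrite coef_expand; apply: tipP_coef sa.
have b0 := tip_neq0 gb.
have c0 : c != 0 by rewrite mulf_neq0 ?invr_eq0.
have q'i : porigin q' = v0 i.
  by rewrite -(pmul_origin q'b) (pmul_origin ap) (tipP_origin sa).
have [t2 e2] := tipP_eps c0 q'i gb q'b.
(* The quotient [c] is made for this equality: the leading terms cancel, and the difference lies
   strictly below [(i, s.2)]. *)
have e12 : (expand (f1 s.1 :* mon p))@_(i, s.2) =
    (expand (eps f0 i :* sc c (mon q' * g)))@_(i, s.2).
  rewrite e2 (coef_expand (f1 s.1 :* mon p)) e1 coef_pmon eqxx mulr1.
  rewrite /c (divfK b0).
  by rewrite coef_expand.
have wlt := tipP_sub t1 t2 e12.
(* If [x] is nonzero, the tip of [msum x] is that of one summand, which is at most the tip of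
   [msum x + msum x']; that sum is the difference just bounded. *)
have xlt e : (expand (msum x))@_e != 0 -> blt e (i, s.2).
  have [->|x0] := eqVneq x 0; first by rewrite msum0 expand0 mcoeff0 eqxx.
  have [l [j [q [_ l0 lq wq lmax]]]] :=
    tipP_msum first_gens_uniform first_gens_free xF xF' (or_introl x0).
  have [l' [j' [q'' [_ l0' lq' xq _]]]] :=
    tipP_msum first_gens_uniform first_gens_free xF (fam0 setT f1') (or_introl x0).
  have jq : blt (j, q) (i, s.2) by apply: wlt; rewrite wE; apply: tip_neq0 wq.
  have jq' : blt (j', q'') (i, s.2).
    case: l' l0' lq' => [l'|l'] /= l0' lq'; last by rewrite mcoeff0 eqxx in l0'.
    have [->//|] := lmax (inl l') _ l0' lq'.
    by move/(wo_trans basis_lt_wo); apply.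
  rewrite msum0 addr0 in xq.
  by move=> /(tip_le xq)[->//|] /(wo_trans basis_lt_wo); apply.
have ty : tipP y i s.2.
  rewrite yE /tipP expandD; apply: (tip_addl basis_lt_wo t1) => e.
  by rewrite expandN mcoeffN oppr_eq0; apply: xlt.
have [_ [v' [u gE]]] := G_uniform Gg.
have gu : g * pv u = g by rewrite gE -!mulrA pvert_idem.
have pu : mon p * pv u = mon p.
  rewrite -(terminus_supp (esym gu) b0) -(pmul_terminus q'b) (pmul_terminus ap).
  exact: pmon_pvert.
split; first exact: ty.
  split; first exact: tipP_neq0 ty.
  (* Both [p] and [g] end at [u], so acting by [u] fixes [msum x + msum x']. Directness makes it fix
     [msum x], and hence [y]. *)
  exists u; have [x2 x2F x2E] := fam_ract (pv u) xF.
  have [x2' x2F' x2E'] := fam_ract (pv u) xF'.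
  have [] := proj2 pi_exact (x - x2) (x' - x2').
  - exact: famD (famN _).
  - exact: famD (famN _).
  - rewrite !msumB addrACA -opprD x2E x2E' -ractDl -wE ractDl ractNl !ractA pu.
    by rewrite -sc_mull -mulrA gu subrr.
  move=> /subr0_eq xx2 _.
  by rewrite yE ractDl ractNl ractA pu -x2E -xx2.
split.
  exists (<< f1 s.1 :* mon p *g s.1 >> - x); last by rewrite msumB msumU yE.
  by apply: famD (famN xF); apply: famU.
(* The defining relation trades the [f1] corrections for a multiple of [g] and multiples of the
   [f1'], all with components in [I]. *)
have -> : y = eps f0 i :* sc c (mon q' * g) + msum x'.
  by rewrite yE; apply/eqP; rewrite subr_eq -addrA -[msum x' + _]addrC -wE addrC subrK.
apply: coprod_idealD.
  by apply: ract_ideal; rewrite sc_mull; apply: (idealMl I_ideal) (G_sub Gg).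
rewrite /msum big_seq; apply: (big_ind _ coprod_ideal0 coprod_idealD) => l.
by case/xF' => _ [r _ <-]; apply: coprod_ideal_ract.
Qed.

Lemma f2'P_prop s y i a : tipP (f1 s.1) i a -> f2'P s y ->
  [/\ tipP y i s.2, unif_vec y, K y &
    sum_of setT (fun l => cyclic_submod I (f1 l)) y].
Proof.
move=> sa [i' [a' [g [q' [z [sa' [Gg [b gb q'b]] az yE]]]]]].
have [ii' aa'] := tipP_unique sa' sa; subst i' a'.
have Izg : I (mon z * g) by apply: (idealMl I_ideal) (G_sub Gg).
have [zb zbE azb] : exists2 zb, pmul z b = Some zb & pmul a zb = Some s.2.
  have := pmulA a z b; rewrite az /= q'b; case: (pmul z b) => //= zb e.
  by exists zb.
have [_ [v sv]] := f1_uniform s.1.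
have av := tipP_terminus sv sa.
have zv : mon z * g = pv v * (mon z * g).
  by rewrite -av; case/pmulE: az => -> _ _; apply: pv_mon_mul.
have [tz _] := tip_mon_mul gb zbE.
have [ty _] := tipP_mul sv sa zv tz azb.
rewrite -yE in ty; split; first exact: ty.
- split; first exact: tipP_neq0 ty.
  have [_ [v' [u gE]]] := G_uniform Gg.
  have gu : g * pv u = g by rewrite gE -!mulrA pvert_idem.
  by exists u; rewrite yE ractA -mulrA gu.
- by rewrite yE; apply: f1_ract_ideal.
exists << y *g s.1 >>; last by rewrite msumU.
move=> l; rewrite -mcoeff_neq0 mcoeffU; case: (s.1 =P l) => [<-|_].
  by split=> //; exists (mon z * g).
by rewrite eqxx.
Qed.

(** * The new generators: incomparable tips and the Groebner property *)

Variables (F2 F2' : T1 * qpath Q -> P).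
Hypothesis F2_spec : forall s, (exists y, f2P s y) -> f2P s (F2 s).
Hypothesis F2'_spec : forall s, (exists y, f2'P s y) -> f2'P s (F2' s).
Local Notation D2 := (sum_dom T2_set U2_set).
Local Notation FF := (sum_fam F2 F2').

Definition index2 (s : (T1 * qpath Q) + (T1 * qpath Q)) : T1 * qpath Q :=
  match s with inl s1 => s1 | inr s2 => s2 end.

Lemma second_gens_prop s : D2 s -> exists i a, [/\ tipP (f1 (index2 s).1) i a,
  X_set a (index2 s).2, tipP (FF s) i (index2 s).2, unif_vec (FF s) & K (FF s)].
Proof.
case: s => s Ds /=; have [i [a [sa sX]]] := Ds; exists i, a.
  have [] := f2P_prop sa (F2_spec (f2P_exists Ds)).
  by split=> //; case: sX.
have [] := f2'P_prop sa (F2'_spec (f2'P_exists Ds)).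
by split=> //; case: sX.
Qed.

Lemma second_gens_free : tip_free D2 FF.
Proof.
move=> s t i p q Ds Dt sp tq pq.
have [i1 [a [sa [as2 _ _] sp' _ _]]] := second_gens_prop Ds.
have [i2 [a' [ta [at2 _ tf] tq' _ _]]] := second_gens_prop Dt.
have [ii1 ps] := tipP_unique sp sp'; have [ii2 qt] := tipP_unique tq tq'.
subst i1 i2 p q.
(* The tippaths [a] and [a'] are both prefixes of the path of [t], hence comparable, and
   incomparability of the first generators applies. *)
have st1 : (index2 s).1 = (index2 t).1.
  have [aa'|a'a] := pdvdl_total (pdvdl_trans as2 pq) at2.
    by have [] := @first_gens_free (inl (index2 s).1) (inl (index2 t).1)
      _ _ _ Logic.I Logic.I sa ta aa'.
  by have [] := @first_gens_free (inl (index2 t).1) (inl (index2 s).1)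
    _ _ _ Logic.I Logic.I ta sa a'a.
(* The path of [s] ends in the tip of some [g] and is a prefix of the path of [t]; as [t] has no
   inner tips, the remainder has length 0. *)
have st2 : (index2 t).2 = (index2 s).2.
  have [_ [_ [_ [_ [g [q' [Gg [b gb q'b]]]] _] _ _ _]]] := second_gens_prop Ds.
  have [r sr] := pq; exact: pmul_eq_length0 sr (tf _ _ _ _ _ Gg gb q'b sr).
have st : index2 s = index2 t.
  by rewrite [LHS]surjective_pairing [RHS]surjective_pairing st1 st2.
(* The tippath is unique, so no index is in both sets; this rules out [s] and [t] on different sides
   of the disjoint sum. *)
have TU e : T2_set e -> U2_set e -> False.
  move=> [j [c [ec Oc]]] [j' [c' [ec' [_ nOc']]]]; apply: nOc'.
  by have [_ <-] := tipP_unique ec ec'.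
case: s t st Ds Dt {sp tq pq sa as2 sp' ta at2 tf tq' st1 st2} => [s|s] [t|t] /= -> // Dt Dt'.
  by case: (TU t).
by case: (TU t).
Qed.

Local Notation XX := (F2 @` T2_set `|` F2' @` U2_set).

Lemma K_sub u w : K u -> K w -> K (u - w).
Proof.
move=> [[x xF <-] uI] [[y yF <-] wI]; split.
  by exists (x - y); [exact: famD (famN yF)|rewrite msumB].
by apply: coprod_idealD uI _; apply: coprod_idealN.
Qed.

Lemma K_ract w (r : R) : K w -> K (w :* r).
Proof.
move=> [[x xF <-] wI]; split; last exact: coprod_ideal_ract.
by have [y yF yE] := fam_ract r xF; exists y.
Qed.

Lemma second_gens_grobner w i q : K w -> tipP w i q ->
  exists s p, [/\ D2 s, tipP (FF s) i p & pdvdl p q].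
Proof.
move=> Kw wq; have [l [a [q0 [la aq0 q0q]]]] := K_tip Kw wq.
have [s Ds sE] : exists2 s, D2 s & index2 s = (l, q0).
  have [O|nO] := pselect (O_set a q0).
    by exists (inl (l, q0)) => //; exists i, a.
  by exists (inr (l, q0)) => //; exists i, a.
have [i' [a' [la' _ sq _ _]]] := second_gens_prop Ds.
rewrite sE /= in la' sq; have [ii' _] := tipP_unique la la'.
by exists s, q0; rewrite ii'.
Qed.

Lemma K0 : K 0.
Proof. by split; [exists 0; [exact: fam0|exact: msum0]|exact: coprod_ideal0]. Qed.

Lemma second_gensP w : XX w -> exists2 s, D2 s & w = FF s.
Proof. by case=> -[s Ds <-]; [exists (inl s)|exists (inr s)]. Qed.

Theorem resolution_step :
  [/\ internal_dsum2 K
        T2_set (fun s => cyclic_submod setT (F2 s))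
        U2_set (fun s => cyclic_submod setT (F2' s)),
      forall w, XX w -> unif_vec w,
      forall w u i j p q, XX w -> XX u -> tipP w i p -> tipP u j q ->
        left_divides (i, p) (j, q) -> w = u,
      XX `<=` K /\ forall w j q, K w -> w != 0 -> tipP w j q ->
        exists u i p, [/\ XX u, tipP u i p & left_divides (i, p) (j, q)] &
      forall s, U2_set s -> sum_of setT (fun l => cyclic_submod I (f1 l)) (F2' s)].
Proof.
have FFu s : D2 s -> unif_vec (FF s) by move=> /second_gens_prop[i [a []]].
have FFK s : D2 s -> K (FF s) by move=> /second_gens_prop[i [a []]].
split.
- exact: (grobner_dsum FFu second_gens_free K0 K_sub K_ract FFK second_gens_grobner).
- by move=> w /second_gensP[s Ds ->]; apply: FFu.
- move=> w u i j p q /second_gensP[s Ds ->] /second_gensP[t Dt ->] sp tq [/= ij pq].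
  by subst j; rewrite (second_gens_free Ds Dt sp tq pq).
- split=> [w /second_gensP[s Ds ->]|w j q Kw _ wq]; first exact: FFK.
  have [s [p [Ds sp pq]]] := second_gens_grobner Kw wq.
  exists (FF s), j, p; split=> //.
  by case: s Ds {sp} => s Ds; [left|right]; exists s.
- move=> s Us; have [i [a [sa _]]] := Us.
  by have [] := f2'P_prop sa (F2'_spec (f2'P_exists Us)).
Qed.

End PathRing.

(** * Specialisation to the path algebra *)

Section PathAlgebra.
Variables (k : fieldType) (Q : quiver).
Local Notation R := (palg k Q).

(** The identity, marking the passage from the ring to its coefficient functions. *)
Definition palg_coef (x : R) : {malg k[qpath Q]} := x.

Lemma palg_coef_inj : injective palg_coef.
Proof. by move=> x y; apply. Qed.

Lemma palg_coefD : {morph palg_coef : x y / x + y}.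
Proof. exact: (fun x y => erefl). Qed.

Lemma palg_coef_mon (p : qpath Q) : palg_coef (pmon k p) = << p >>.
Proof. exact: erefl. Qed.

Lemma palg_coefZ (c : k) (x : R) (p : qpath Q) :
  (palg_coef (c *: x))@_p = c * (palg_coef x)@_p.
Proof. exact: (mcoeffZ c (palg_coef x) p). Qed.

Lemma palg_coefM (x y : R) (s : qpath Q) : (palg_coef (x * y))@_s =
  \sum_(p <- msupp (palg_coef x)) \sum_(q <- msupp (palg_coef y))
    ((palg_coef x)@_p * (palg_coef y)@_q) *+ (pmul p q == Some s).
Proof.
rewrite palg_mulE /palg_mul /palg_coef raddf_sum; apply: eq_bigr => p _.
rewrite raddf_sum; apply: eq_bigr => q _; rewrite /= /monmul.
by case: pmul => [r|]; rewrite ?mcoeff0 // mcoeffU.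
Qed.

Variables (lt : rel (qpath Q)) (lt_adm : admissible lt).
Variables (T0 : choiceType) (v0 : T0 -> qvert Q) (f0 : T0 -> R).
Hypothesis f0_uniform : forall i, f0 i != 0 /\ f0 i * pvert k (v0 i) = f0 i.

Definition palg_expand : coprod f0 -> {malg k[(T0 * qpath Q)%type]} :=
  expand palg_coef_inj palg_coef_mon palg_coefM f0_uniform.

(** [expandK] shows that the specification has a solution, so the chosen one satisfies it;
    [expand_unique] then recovers it from its sum. Equality as functions permits rewriting inside
    the definitions of tips. *)
Lemma expansionE : @expansion k Q T0 v0 f0 = palg_expand.
Proof.
apply/funext => w.
have ex : exists c, is_expansion v0 w c.
  exists (palg_expand w); split.
    exact: (expand_origin palg_coefD lt_adm (f0_uniform := f0_uniform)).
  symmetry.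
  exact: (expandK palg_coef_inj palg_coefD palg_coef_mon palg_coefZ palg_coefM
    lt_adm f0_uniform).
have [co wE] := xgetPex (0 : {malg k[(T0 * qpath Q)%type]}) ex.
rewrite -/(expansion v0 w) in co wE.
rewrite [in RHS]wE; symmetry.
exact: (expand_unique palg_coef_inj palg_coefD palg_coef_mon palg_coefZ palg_coefM
  lt_adm f0_uniform co).
Qed.

End PathAlgebra.

Theorem theorem3p1
  (k : fieldType) (Q : quiver)
  (lt : rel (qpath Q)) (lt_adm : admissible lt)
  (I : set (palg k Q)) (I_ideal : two_sided_ideal I)
  (Lam : pzRingType) (quo : {rmorphism palg k Q -> Lam})
  (quo_surj : forall y, exists x, quo x = y)
  (quo_ker : forall x, quo x = 0 <-> I x)
  (G : set (palg k Q))
  (G_grobner : grobner_basis lt I G)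
  (G_reduced : tip_reduced lt G)
  (G_uniform : forall g, G g -> uniform g)
  (M : lmodType Lam^c)
  (T0 : choiceType) (lt0 : rel T0) (lt0_wo : well_order lt0)
  (v0 : T0 -> qvert Q) (f0 : T0 -> palg k Q)
  (f0_uniform : forall i, f0 i != 0 /\ f0 i * pvert k (v0 i) = f0 i)
  (T1 U1 : choiceType) (f1 : T1 -> coprod f0) (f1' : U1 -> coprod f0)
  (f1_uniform : forall i, right_uniform (f1 i))
  (f1'_uniform : forall j, right_uniform (f1' j))
  (f1'_ideal : forall j, coprod_ideal I (f1' j))
  (f1_reduced : right_tip_reduced lt lt0 v0 (range f1 `|` range f1'))
  (pi : {additive coprod f0 -> M})
  (pi_linear : forall w r, pi (w :* r) = pi w :* quo r)
  (pi_surj : forall m, exists w, pi w = m)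
  (pi_exact : internal_dsum2 [set w | pi w = 0]
     setT (fun i => cyclic_submod setT (f1 i))
     setT (fun j => cyclic_submod setT (f1' j))) :
  let K := sum_of setT (fun i => cyclic_submod setT (f1 i))
           `&` @coprod_ideal _ _ f0 I in
  let T2 := T2set lt lt0 v0 G f1 in
  let U2 := U2set lt lt0 v0 G f1 in
  let F2 := f2 lt lt0 v0 G f1 f1' in
  let F2' := f2' lt lt0 v0 G f1 in
  let X := F2 @` T2 `|` F2' @` U2 in
  [/\ internal_dsum2 K
        T2 (fun s => cyclic_submod setT (F2 s))
        U2 (fun s => cyclic_submod setT (F2' s)),
      forall x, X x -> right_uniform x,
      right_tip_reduced lt lt0 v0 X,
      right_grobner_basis lt lt0 v0 K X &
      forall s, U2 s ->
        sum_of setT (fun j => cyclic_submod I (f1 j)) (F2' s)].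
Proof.
cbv zeta.
have eE := expansionE lt_adm f0_uniform.
unfold right_tip_reduced, is_tipP in f1_reduced; rewrite eE in f1_reduced.
unfold T2set, U2set, f2, f2', f2_spec, f2'_spec, right_tip_reduced,
  right_grobner_basis, is_tipP.
rewrite eE.
have scM (c : k) (x y : palg k Q) : c *: (x * y) = (c *: x) * y by exact: palg_scalerAl.
have H := @resolution_step k Q (palg k Q) (@palg_coef k Q) _ (@pmon k Q)
  (@palg_coef_inj k Q) (@palg_coefD k Q) (@palg_coef_mon k Q) (@palg_coefZ k Q)
  (@palg_coefM k Q) lt lt_adm T0 lt0 v0 f0 lt0_wo f0_uniform scM I G I_ideal
  (proj1 G_grobner) (proj2 G_grobner) G_uniform Lam quo M quo_ker T1 U1 f1 f1'
  f1_uniform f1'_uniform f1'_ideal f1_reduced pi pi_linear pi_exact.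
(* A value picked by [xget], with default 0, meets its specification once a solution exists: exactly
   the hypotheses on [F2] and [F2']. *)
exact: (H _ _ (fun s => @xgetPex _ 0 _) (fun s => @xgetPex _ 0 _)).
Qed.
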